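(* Let $0<\lambda_1<1<\lambda_2$ be such that $\lambda_1\lambda_2<1$ and let $\phi\in C_c^{\infty}(\mathbb{R})$ (smooth with compact support). Then $h:\epsilon\mapsto\int_{\mathbb{R}}\phi\,d\mu_{\lambda_1+\epsilon,\lambda_2}$ (defined for $|\epsilon|$ small) is infinitely differentiable at $0$, and for every $l\in\mathbb{N}$, $l\ge1$, $$h^{(l)}(0)=\int_{\Sigma}\frac{d^l}{d\epsilon^l}\big(\phi\circ X(\epsilon)\big)\Big|_{\epsilon=0}\,d\nu=\int_{\Sigma}\ \sum_{k_1+2k_2+\cdots+lk_l=l}L(k_1,\dots,k_l)\,\phi^{(k)}(X)\prod_{j=1}^{l}\big(X^{(j)}\big)^{k_j}\,d\nu,$$ where the sum is over all non-negative integers $k_1,\dots,k_l$ with $k_1+2k_2+\cdots+lk_l=l$, $k:=k_1+\cdots+k_l$, and $L(k_1,\dots,k_l):=\frac{l!}{k_1!(1!)^{k_1}\cdots k_l!(l!)^{k_l}}$.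
   Context: Fix $d_1,d_2\in\mathbb{R}$ such that the maps $f_1(x)=\lambda_1x+d_1$ and $f_2(x)=\lambda_2x+d_2$ do not have the same fixed point, i.e. $\frac{d_1}{1-\lambda_1}\ne\frac{d_2}{1-\lambda_2}$. For $0<a<1<b$ with $ab<1$, $\mu_{a,b}$ denotes the unique stationary measure of the iterated function system $x\mapsto ax+d_1$, $x\mapsto bx+d_2$ with probabilities $(\frac12,\frac12)$, i.e. the unique Borel probability measure $\mu$ on $\mathbb{R}$ equal to $\frac12$ of its push-forward by the first map plus $\frac12$ of its push-forward by the second map. $\Sigma=\{1,2\}^{\mathbb{N}}$ with elements $(i_1,i_2,\dots)$, and $\nu=(\frac12,\frac12)^{\mathbb{N}}$ is the Bernoulli measure on $\Sigma$. For $|\epsilon|$ small enough that $0<\lambda_1+\epsilon<1$ and $(\lambda_1+\epsilon)\lambda_2<1$, put $\lambda_1(\epsilon)=\lambda_1+\epsilon$, $\lambda_2(\epsilon)=\lambda_2$ and $$X(\epsilon)=\sum_{m=0}^{\infty}\lambda_{i_1}(\epsilon)\cdots\lambda_{i_m}(\epsilon)\,d_{i_{m+1}}$$ (empty product $=1$), which converges $\nu$-almost everywhere and has law $\mu_{\lambda_1+\epsilon,\lambda_2}$; $X:=X(0)$. The random variable $X^{(j)}$, $j\ge1$, is the (term by term) $j$-th derivative of $X(\epsilon)$ at $\epsilon=0$: $$X^{(j)}=\frac{j!}{\lambda_1^j}\sum_{m=1}^{\infty}\lambda_{i_1}\cdots\lambda_{i_m}\,d_{i_{m+1}}\binom{o(m)}{j},$$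 where $o(m)$ is the number of $1$'s among $i_1,\dots,i_m$, and $\binom{n}{k}=0$ if $k>n$. *)

(* Defs.v *)
From HB Require Import structures.
From mathcomp Require Import all_boot all_order all_algebra.
From mathcomp Require Import all_classical all_reals all_analysis.
Import Order.TTheory GRing.Theory Num.Theory.
Import numFieldNormedType.Exports.
Set Implicit Arguments.
Unset Strict Implicit.
Unset Printing Implicit Defensive.

Local Open Scope ring_scope.
Local Open Scope classical_set_scope.

(* Differentiability of order n+1 at x needs the n-th derivative in a
   neighbourhood of x; quantifying over all n, it amounts to the same to ask
   that each iterated derivative be derivable near x.  The neighbourhood may
   depend on n. *)
Definition smooth_at (R : realType) (f : R -> R) (x : R) : Prop :=
  forall n : nat, \forall y \near x, derivable (f^`(n)) y 1.

Definition test_function (R : realType) (phi : R -> R) : Prop :=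
  (forall (n : nat) (x : R), derivable (phi^`(n)) x 1) /\
  compact (closure [set x | phi x != 0]).

Definition stationary (R : realType) (d1 d2 a b : R)
    (mu : probability (measurableTypeR R) R) : Prop :=
  forall A : set (measurableTypeR R), measurable A ->
    mu A = ((2^-1)%:E *
              pushforward mu (fun x => (a * x + d1)%R : measurableTypeR R) A +
            (2^-1)%:E *
              pushforward mu (fun x => (b * x + d2)%R : measurableTypeR R) A)%E.

(* Sequences of symbols are indexed from 0, so that i_(m+1) is s m; the symbol
   1 is encoded by true and the symbol 2 by false. *)
Definition cylinder (w : nat -> bool) (n : nat) : set (nat -> bool) :=
  [set s | forall i, (i < n)%N -> s i = w i].

Definition cylinders : set (set (nat -> bool)) :=
  [set C | exists w n, C = cylinder w n].

Definition Sigma := g_sigma_algebraType cylinders.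

(* The cylinders, with the empty set, form a pi-system that generates the
   sigma-algebra of Sigma: these values determine nu. *)
Definition bernoulli_half (R : realType) (nu : probability Sigma R) : Prop :=
  forall (w : nat -> bool) (n : nat), nu (cylinder w n) = ((2^-1) ^+ n)%:E.

Definition symb (R : realType) (x1 x2 : R) (i : bool) : R :=
  if i then x1 else x2.

Definition weight (R : realType) (a b : R) (s : Sigma) (m : nat) : R :=
  \prod_(0 <= k < m) symb a b (s k).

Definition ones (s : Sigma) (m : nat) : nat := (\sum_(0 <= k < m) s k)%N.

(* With a = lambda_1 + eps and b = lambda_2 this is X(eps).  Off the set where
   the series converges, the value is the default one of limn. *)
Definition Xsum (R : realType) (d1 d2 a b : R) (s : Sigma) : R :=
  limn (fun n => \sum_(0 <= m < n) weight a b s m * symb d1 d2 (s m)).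

Definition Xder (R : realType) (d1 d2 a b : R) (j : nat) (s : Sigma) : R :=
  (j`!)%:R / a ^+ j *
  limn (fun n => \sum_(1 <= m < n)
                   weight a b s m * symb d1 d2 (s m) * ('C(ones s m, j))%:R).

(* A tuple (k_1, ..., k_l) is k : {ffun 'I_l -> 'I_l.+1} with k_(j+1) = k j;
   the bound k_j <= l follows from k_1 + 2 k_2 + ... + l k_l = l. *)
Definition faa_coef (R : realType) (l : nat) (k : {ffun 'I_l -> 'I_l.+1}) : R :=
  (l`!)%:R / \prod_(j < l) (((k j)`!)%:R * ((j.+1)`!)%:R ^+ k j).

Definition faa_sum (R : realType) (phi : R -> R) (x : R) (y : nat -> R)
    (l : nat) : R :=
  \sum_(k : {ffun 'I_l -> 'I_l.+1} | (\sum_(j < l) j.+1 * k j == l)%N)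
    faa_coef R k * derive1n (\sum_(j < l) k j)%N phi x * \prod_(j < l) y j.+1 ^+ k j.

(* Main.v *)
Require Import Defs.
From HB Require Import structures.
From mathcomp Require Import all_boot all_order all_algebra.
From mathcomp Require Import all_classical all_reals all_analysis measurable_realfun.
From mathcomp Require Import ring lra zify.
Import Order.TTheory GRing.Theory Num.Theory.
Import numFieldNormedType.Exports.
Set Implicit Arguments.
Unset Strict Implicit.
Unset Printing Implicit Defensive.
Local Open Scope ring_scope.
Local Open Scope classical_set_scope.

(** Let p = d2 / (1 - l2) be the fixed point of the expanding map.  Translating p
    to the origin gives X(e) = p + (d1 - (1 - l1 - e) p) S, where S is the sum of
    the products lambda_{i_1} ... lambda_{i_m} over the m with i_{m+1} = 1.  These
    terms are positive, so a bound on |X(e)| bounds every product by one constant C.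

    As l1 l2 < 1, there are al, be, q with al^q > l1, be^q >= l2 and al + be < 2;
    hence for some sg > 1 the sum z of the products of the numbers sg al, sg be
    is integrable.  A product A <= C also satisfies A <= g^q, where g <= z sg^(-m)
    is the corresponding product of al, be, and therefore (A / C)^N <= z sg^(-m).
    So on the event that X(e) lies in the support of phi, every X^(j)(e) is
    O(z^(1/N)) uniformly for small e.  The n-th derivative of phi o X(e), n <= N,
    has degree at most N in the X^(j) by Faa di Bruno's formula: it is O(z), and
    the integral may be differentiated N times under the integral sign.

    Finally the integral of phi against mu is that of phi o X against nu: iterate
    the stationarity equation m times and let m go to infinity. *)

(** * Measurability of pointwise limits, and integrals up to null sets *)

Section MeasureComplements.
Context d {T : measurableType d} {R : realType}.

(** All quantifiers range over natural numbers, so that a set of convergence is built from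
    measurable sets by countable unions and intersections. *)
Lemma cvgn_cauchyP (u : R^nat) : cvgn u <->
  forall k, exists N, forall n, `|u (N + n)%N - u N| <= k.+1%:R^-1.
Proof.
split=> [/cvg_ex[/= l /cvgrPdist_le ul] k|uC].
  have [|N _ uN] := ul (k.+1%:R^-1 / 2); first by rewrite divr_gt0.
  exists N => n; rewrite (le_trans (ler_distD l _ _))// [leRHS]splitr.
  apply: lerD; last exact: uN (leqnn N).
  by rewrite distrC; apply: uN; exact: leq_addr.
apply: cauchy_cvg; apply: cauchy_exP => e e0.
have [k ke] : exists k : nat, k.+1%:R^-1 < e.
  near \oo => k; exists k; near: k; exact: (near_infty_natSinv_lt (PosNum e0)).
have [N uN] := uC k; exists (u N), N => // n /= Nn.
by rewrite /ball /= distrC (le_lt_trans _ ke)// -(subnKC Nn).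
Unshelve. all: by end_near. Qed.

(* Where the sequence diverges, limn is the constant default value. *)
Lemma measurable_limn (h : nat -> T -> R) : (forall n, measurable_fun setT (h n)) ->
  measurable_fun setT (fun x => limn (h ^~ x)).
Proof.
move=> mh; pose D := [set x | cvgn (h ^~ x)].
have mD : measurable D.
  rewrite (_ : D = \bigcap_k \bigcup_N \bigcap_n
      [set x | `|h (N + n)%N x - h N x| <= k.+1%:R^-1]); last first.
    apply/seteqP; split=> x /=.
      by move=> /cvgn_cauchyP H k _; have [N HN] := H k; exists N => // n _; exact: HN.
    move=> H; apply/cvgn_cauchyP => k; have [N _ HN] := H k I.
    by exists N => n; exact: (HN n I).
  apply: bigcapT_measurable => k; apply: bigcupT_measurable => N.
  apply: bigcapT_measurable => n; rewrite -[X in measurable X]setTI.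
  apply: measurable_fun_le => //; apply: measurableT_comp => //.
  exact: measurable_funB.
rewrite -(setUv D); apply/measurable_funU => //; first exact: measurableC.
split.
  apply: (@measurable_fun_cvg _ _ _ D h) => [m|x Dx]; last exact: Dx.
  exact: measurable_funTS.
apply: (eq_measurable_fun (cst point)) => [x|]; last exact: measurable_cst.
by rewrite inE => /dvgP ->.
Qed.

Local Open Scope ereal_scope.
Variable mu : {measure set T -> \bar R}.

Import HBNNSimple.

(* No measurability of f is needed, since the integral of a non-negative
   function is a supremum over the simple functions below it. *)
Lemma integral_setC_null (f : T -> \bar R) (D : set T) : measurable D ->
  mu (~` D) = 0 -> \int[mu]_x f x = \int[mu]_(x in D) f x.
Proof.
move=> mD D0.
suff H (g : T -> \bar R) : (forall x, 0 <= g x) ->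
    \int[mu]_x g x = \int[mu]_(x in D) g x.
  by rewrite integralE [RHS]integralE !H.
move=> g0; rewrite [RHS]integral_mkcond.
have gD0 x : 0 <= (g \_ D) x by rewrite patchE; case: ifP.
rewrite !ge0_integralTE//; apply/eqP; rewrite eq_le; apply/andP; split.
  apply: ge_ereal_sup => _ [h hg <-]; apply: ereal_sup_ubound.
  (* The restriction of [h] to [D] lies below [g] on [D], and has the integral of [h] since the
     complement of [D] is null. *)
  exists (proj_nnsfun h mD) => [x|].
    rewrite /= mindicE patchE; case: ifPn => _; last by rewrite mulr0.
    by rewrite mulr1; exact: hg.
  rewrite -[in LHS](mrestrict h mD) -integral_nnsfun//.
  have -> : sintegral mu h = sintegral mu (h \_ setT) by rewrite patch_setT.
  rewrite -integral_nnsfun// [RHS](@ge0_negligible_integral _ _ _ mu setT (~` D))//.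
  - by rewrite setTD setCK.
  - exact: measurableC.
  - by apply/measurable_EFinP.
  - by move=> x _; rewrite lee_fin.
apply: ge_ereal_sup => _ [h hg <-]; apply: ereal_sup_ubound; exists h => // x.
by rewrite (le_trans (hg x))// patchE; case: ifP.
Qed.

End MeasureComplements.

(** * Bounded convergence for a probability measure *)

Section BoundedConvergence.
Context d {T : measurableType d} {R : realType} (P : probability T R).

Lemma integrable_bounded (f : T -> R) (M : R) : measurable_fun setT f ->
  (forall s, `|f s| <= M) -> P.-integrable setT (EFin \o f).
Proof.
move=> mf fM; apply: measurable_bounded_integrable => //.
  by apply: le_lt_trans (ltry 1); exact: probability_le1.
exists M; split; first exact: num_real.
by move=> x Mx s _; exact: le_trans (fM s) (ltW Mx).
Qed.

(** Convergence is asked only on a set [D] of full measure: over [nu], the series X may diverge on a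
    null set; over [mu], [D] will be the whole line. *)
Lemma bounded_cvg_Rintegral (f_ : nat -> T -> R) (f : T -> R) (M : R) (D : set T) :
  measurable D -> P (~` D) = 0%E -> (forall n, measurable_fun setT (f_ n)) ->
  measurable_fun setT f -> (forall n s, `|f_ n s| <= M) ->
  (forall s, D s -> f_ n s @[n --> \oo] --> f s) ->
  (\int[P]_s f_ n s)%R @[n --> \oo] --> (\int[P]_s f s)%R.
Proof.
move=> mD PD mf_ mf fM cf.
have ae_cf : {ae P, forall s, setT s -> (f_ n s)%:E @[n --> \oo] --> (f s)%:E}.
  exists (~` D); split => //; first exact: measurableC.
  move=> s ns Ds; apply: ns => _; apply: cvg_EFin; first exact: nearW.
  exact: cf.
have intM : P.-integrable setT (fun=> M%:E).
  exact: (@integrable_bounded (cst M) `|M|).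
have fM' : {ae P, forall s n, setT s -> (`|(f_ n s)%:E| <= M%:E)%E}.
  by apply: aeW => s n _; rewrite lee_fin.
have mEf_ n : measurable_fun setT (fun s => (f_ n s)%:E) by exact/measurable_EFinP.
have mEf : measurable_fun setT (fun s => (f s)%:E) by exact/measurable_EFinP.
have [intf _ cvf] := dominated_convergence measurableT mEf_ mEf ae_cf intM fM'.
apply: fine_cvg; rewrite /Rintegral fineK//.
exact: integrable_fin_num.
Qed.

End BoundedConvergence.

(** * Faa di Bruno's formula *)

Section FaaDiBruno.
Context {R : realType}.
Implicit Types (phi : R -> R) (y : nat -> R).


Definition weighted_degree N (k : {ffun 'I_N -> 'I_N.+1}) : nat := (\sum_(j < N) j.+1 * k j)%N.

(* The n-th term of Faa di Bruno's formula with N >= n parts: for fixed N the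
   index type does not change along an induction on n. *)
Definition faa_trunc phi y N n : R :=
  \sum_(k : {ffun 'I_N -> 'I_N.+1} | weighted_degree k == n)
    (n`!)%:R / \prod_(j < N) (((k j)`!)%:R * ((j.+1)`!)%:R ^+ k j) *
    derive1n (\sum_(j < N) k j)%N phi (y 0) * \prod_(j < N) y j.+1 ^+ k j.

(** [inord] falls back on 0 beyond N, so raising a part is faithful only while [k j < N]; lowering
    always is, and leaves a zero part at zero. *)
Definition incr_part N (j : 'I_N) (k : {ffun 'I_N -> 'I_N.+1}) : {ffun 'I_N -> 'I_N.+1} :=
  [ffun i => if i == j then inord (k i).+1 else k i].
Definition decr_part N (j : 'I_N) (k : {ffun 'I_N -> 'I_N.+1}) : {ffun 'I_N -> 'I_N.+1} :=
  [ffun i => if i == j then inord (k i).-1 else k i].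

Lemma val_decr_part N (j : 'I_N) (k : {ffun 'I_N -> 'I_N.+1}) i :
  decr_part j k i = (if i == j then (k i).-1 else k i) :> nat.
Proof.
rewrite ffunE; case: eqP => // _; rewrite inordK//.
by rewrite (leq_ltn_trans (leq_pred _)).
Qed.

Lemma val_incr_part N (j : 'I_N) (k : {ffun 'I_N -> 'I_N.+1}) i :
  (k j < N)%N -> incr_part j k i = (if i == j then (k i).+1 else k i) :> nat.
Proof. by move=> kN; rewrite ffunE; case: eqP => // ->; rewrite inordK. Qed.

Lemma leq_weighted_degree N (k : {ffun 'I_N -> 'I_N.+1}) j : (k j <= weighted_degree k)%N.
Proof. by rewrite /weighted_degree (bigD1 j)//= (leq_trans _ (leq_addr _ _))// leq_pmull. Qed.

Lemma leq_sum_weighted_degree N (k : {ffun 'I_N -> 'I_N.+1}) : (\sum_(j < N) k j <= weighted_degree k)%N.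
Proof. by apply: leq_sum => j _; rewrite leq_pmull. Qed.

Lemma weighted_degree_decr N (j : 'I_N) (k : {ffun 'I_N -> 'I_N.+1}) :
  (0 < k j)%N -> weighted_degree k = (weighted_degree (decr_part j k) + j.+1)%N.
Proof.
move=> k0; rewrite /weighted_degree (bigD1 j)//= [in RHS](bigD1 j)//= val_decr_part eqxx.
rewrite [in RHS](eq_bigr (fun i : 'I_N => (i.+1 * k i)%N)); last first.
  by move=> i /negPf ij; rewrite val_decr_part ij.
by rewrite -{1}(prednK k0); nia.
Qed.

Lemma sum_decr_part N (j : 'I_N) (k : {ffun 'I_N -> 'I_N.+1}) :
  (0 < k j)%N -> (\sum_(i < N) k i = (\sum_(i < N) decr_part j k i).+1)%N.
Proof.
move=> k0; rewrite (bigD1 j)//= [in RHS](bigD1 j)//= val_decr_part eqxx.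
rewrite [in RHS](eq_bigr (fun i : 'I_N => nat_of_ord (k i))); last first.
  by move=> i /negPf ij; rewrite val_decr_part ij.
by rewrite -{1}(prednK k0) addSn.
Qed.

Lemma incr_partK N (j : 'I_N) (k : {ffun 'I_N -> 'I_N.+1}) :
  (k j < N)%N -> decr_part j (incr_part j k) = k.
Proof.
move=> kN; apply/ffunP => i; apply: val_inj; rewrite /= val_decr_part val_incr_part//.
by case: eqP.
Qed.

Lemma decr_partK N (j : 'I_N) (k : {ffun 'I_N -> 'I_N.+1}) :
  (0 < k j)%N -> incr_part j (decr_part j k) = k.
Proof.
move=> k0; apply/ffunP => i; apply: val_inj.
rewrite /= val_incr_part; first by rewrite val_decr_part; case: eqP => // ->; rewrite prednK.
by rewrite val_decr_part eqxx prednK// -ltnS.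
Qed.

(* Differentiating the j-th factor lowers k_j by one; this lets the sum be
   compared with the one over a smaller total weight. *)
Lemma sum_decr_shift N (j : 'I_N) n (G : {ffun 'I_N -> 'I_N.+1} -> R) : (n < N)%N ->
  \sum_(k : {ffun 'I_N -> 'I_N.+1} | (weighted_degree k == n + j.+1)%N && (0 < k j)%N) G (decr_part j k)
  = \sum_(k : {ffun 'I_N -> 'I_N.+1} | weighted_degree k == n) G k.
Proof.
move=> nN.
rewrite [RHS](reindex_onto (decr_part j) (incr_part j)); last first.
  by move=> k /eqP kn; rewrite incr_partK// (leq_ltn_trans (leq_weighted_degree k j))// kn.
apply: eq_bigl => k.
have [k0|k0] := ltnP 0 (k j).
  by rewrite andbT decr_partK// eqxx andbT (weighted_degree_decr k0) eqn_add2r.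
(* If k_j = 0, lowering leaves it at 0 and raising then gives 1: such tuples fail the inverse
   condition of the reindexing. *)
rewrite andbF; apply/esym/negbTE/negP => /andP[/eqP wn /eqP /ffunP /(_ j) /(congr1 val)] /=.
rewrite val_incr_part ?eqxx val_decr_part ?eqxx; first by (move: k0; case: (nat_of_ord (k j))).
by move: k0; rewrite leqn0 => /eqP ->; exact: leq_ltn_trans nN.
Qed.


Lemma is_derive_bigsum (I : Type) (r : seq I) (P : pred I) (F : I -> R -> R)
    (dF : I -> R) (x : R) : (forall i, P i -> is_derive x 1 (F i) (dF i)) ->
  is_derive x 1 (fun e => \sum_(i <- r | P i) F i e) (\sum_(i <- r | P i) dF i).
Proof.
move=> dFF; elim: r => [|i r IH].
  under eq_fun do rewrite big_nil.
  by rewrite big_nil; exact: is_derive_cst.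
rewrite big_cons; case: ifPn => Pi; last first.
  by under eq_fun do rewrite big_cons (negPf Pi).
under eq_fun do rewrite big_cons Pi.
by have := dFF _ Pi => dFi; exact: is_deriveD.
Qed.

Lemma is_derive_bigprod (I : eqType) (r : seq I) (F : I -> R -> R)
    (dF : I -> R) (x : R) : uniq r -> (forall i, is_derive x 1 (F i) (dF i)) ->
  is_derive x 1 (fun e => \prod_(i <- r) F i e)
    (\sum_(j <- r) dF j * \prod_(i <- r | i != j) F i x).
Proof.
move=> + dFF; elim: r => [_|j r IH /= /andP[jr ur]].
  under eq_fun do rewrite big_nil.
  by rewrite big_nil; exact: is_derive_cst.
under eq_fun do rewrite big_cons.
apply: (is_derive_eq (is_deriveM (dFF j) (IH ur))).
rewrite big_cons big_cons eqxx /= [X in _ * X + _](_ : _ = \prod_(i <- r) F i x); last first.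
  rewrite big_seq_cond [RHS]big_seq; apply: eq_bigl => i.
  by rewrite andbC; case: eqP => //= ->; rewrite (negPf jr).
rewrite addrC; congr (_ + _); first by rewrite [LHS]mulrC.
rewrite /GRing.scale /= mulr_sumr [LHS]big_seq [RHS]big_seq; apply: eq_bigr => i ir.
rewrite big_cons ifT; first by rewrite mulrCA.
by apply: contraNneq jr => ->.
Qed.


(** Up to the global n!, a Faa di Bruno coefficient is absorbed in a product of these divided powers
    of y_(j+1) / (j+1)!, whose derivatives lower the exponent without a numerical factor. *)
Definition divided_power y j i : R := (y j.+1 / (j.+1)`!%:R) ^+ i / i`!%:R.

Lemma faa_truncE phi y N n : faa_trunc phi y N n = n`!%:R *
  \sum_(k : {ffun 'I_N -> 'I_N.+1} | weighted_degree k == n)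
    derive1n (\sum_(j < N) k j)%N phi (y 0) * \prod_(j < N) divided_power y j (k j).
Proof.
rewrite /faa_trunc mulr_sumr; apply: eq_bigr => k _.
rewrite -!mulrA; congr (_ * _); rewrite mulrCA; congr (_ * _).
rewrite -prodfV -big_split /=; apply: eq_bigr => j _.
by rewrite /divided_power expr_div_n invfM mulrC -mulrA; congr (_ * _); rewrite mulrC.
Qed.

(** The order of the derivative of [phi] exceeds the number of parts by one: this is what a term
    becomes when [phi] is differentiated, and what remains of a term when one of its parts is split
    off. *)
Definition shifted_term phi y N (k : {ffun 'I_N -> 'I_N.+1}) : R :=
  derive1n (\sum_(j < N) k j).+1 phi (y 0) * \prod_(j < N) divided_power y j (k j).

Definition shifted_sum phi y N n : R :=
  \sum_(k : {ffun 'I_N -> 'I_N.+1} | weighted_degree k == n) shifted_term phi y k.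

(** The guard makes the sum zero for a negative weight, where truncated subtraction would give the
    weight 0. *)
Definition shifted_coef phi y N m j : R :=
  if (j < m)%N then shifted_sum phi y N (m - j.+1)%N else 0.

Lemma shifted_term_decr phi y N (j : 'I_N) (k : {ffun 'I_N -> 'I_N.+1}) : (0 < k j)%N ->
  derive1n (\sum_(j < N) k j)%N phi (y 0) *
    (divided_power y j (k j).-1 * \prod_(i < N | i != j) divided_power y i (k i)) = shifted_term phi y (decr_part j k).
Proof.
move=> k0; rewrite /shifted_term (sum_decr_part k0) [X in _ = _ * X](bigD1 j)//= val_decr_part eqxx.
congr (_ * (_ * _)); apply: eq_bigr => i /negPf ij.
by rewrite val_decr_part ij.
Qed.

Lemma shifted_coefE phi y N (j : 'I_N) m : (m <= N)%N ->
  \sum_(k : {ffun 'I_N -> 'I_N.+1} | (weighted_degree k == m) && (0 < k j)%N) shifted_term phi y (decr_part j k)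
  = shifted_coef phi y N m j.
Proof.
move=> mN; rewrite /shifted_coef; case: ltnP => jm.
  rewrite -{1}(subnK jm) sum_decr_shift// (leq_trans _ mN)//.
  by rewrite ltn_subrL /= (leq_trans _ jm).
rewrite big_pred0// => k; apply/negbTE/negP => /andP[/eqP wk /weighted_degree_decr].
by rewrite wk => mE; move: jm; rewrite mE leqNgt leq_addl.
Qed.

(** The factor n + 1 of (n + 1)! is the weighted degree of each tuple, hence the sum of the (j + 1)
    k_j. Multiplied by (j + 1) k_j, the j-th divided power becomes y_(j+1) / j! times the one of
    exponent k_j - 1; regrouping by the lowered tuple leaves sums of weight n - j. *)
Lemma faa_truncS phi y N n : (n < N)%N -> faa_trunc phi y N n.+1 = n`!%:R *
  (y 1%N * shifted_sum phi y N n + \sum_(j < N) (y j.+2 / (j.+1)`!%:R) * shifted_coef phi y N n j).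
Proof.
move=> nN; rewrite faa_truncE factS mulnC natrM -mulrA; congr (_ * _).
transitivity (\sum_(j < N) (y j.+1 / j`!%:R) * shifted_coef phi y N n.+1 j).
  rewrite mulr_sumr.
  under [RHS]eq_bigr do rewrite -shifted_coefE// mulr_sumr big_mkcondr /=.
  rewrite [RHS]exchange_big /=; apply: eq_bigr => k /eqP wk.
  rewrite -wk /weighted_degree natr_sum mulr_suml; apply: eq_bigr => j _.
  case: ltnP => [kj|]; last by rewrite leqn0 => /eqP ->; rewrite muln0 mul0r.
  rewrite -(shifted_term_decr _ _ kj) mulrCA [RHS]mulrCA; congr (_ * _).
  rewrite (bigD1 j)//= mulrA [RHS]mulrA; congr (_ * _).
  rewrite /divided_power; case: (nat_of_ord (k j)) kj => // m _ /=.
  rewrite exprS !factS !natrM; field.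
  by rewrite !nat1r !pnatr_eq0 -!lt0n !fact_gt0.
have N0 : (0 < N)%N by exact: leq_ltn_trans nN.
rewrite -(big_mkord xpredT (fun j => y j.+1 / j`!%:R * shifted_coef phi y N n.+1 j)).
rewrite -(big_mkord xpredT (fun j => y j.+2 / j.+1`!%:R * shifted_coef phi y N n j)).
rewrite big_ltn// big_add1 fact0 divr1.
rewrite -[X in _ = _ + \sum_(0 <= i < X) _](prednK N0) big_nat_recr//=.
rewrite /shifted_coef subn1 ltn0Sn /=.
(* After the shift of index, the term j = N - 1 has negative weight, as n < N, and vanishes. *)
have -> : (N.-1 < n)%N = false by rewrite prednK//; apply/negbTE; rewrite -ltnNge.
by rewrite mulr0 addr0.
Qed.

Lemma is_derive_divided_power (Y : nat -> R -> R) j i (x : R) :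
  is_derive x 1 (Y j.+1) (Y j.+2 x) ->
  is_derive x 1 (fun e => divided_power (Y^~ e) j i)
    (if i is i'.+1 then Y j.+2 x / (j.+1)`!%:R * divided_power (Y^~ x) j i' else 0).
Proof.
move=> dY; rewrite /divided_power.
rewrite [X in is_derive _ _ X _](_ : _ =
  (i`!%:R)^-1 \*: ((j.+1`!%:R)^-1 \*: Y j.+1) ^+ i); last first.
  by apply/funext => e; rewrite !fctE /GRing.scale /= mulrC [_ / _]mulrC.
apply: is_derive_eq.
case: i => [|i]; rewrite /GRing.scale /=; first by rewrite !mul0r mulr0.
rewrite factS natrM -[_ *: Y _ _]/(_ * Y _ _) [Y j.+1 x / _]mulrC; field.
by rewrite !nat1r !pnatr_eq0 -!lt0n !fact_gt0.
Qed.

(** By the product rule, differentiating [phi] gives the term in y_1 of [faa_truncS];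
    differentiating the j-th divided power trades one y_(j+1) for y_(j+2) and gives the terms of its
    sum. *)
Lemma is_derive_faa_trunc phi (Y : nat -> R -> R) N n (x : R) : (n < N)%N ->
  (forall m z, derivable (derive1n m phi) z 1) ->
  (forall j, is_derive x 1 (Y j) (Y j.+1 x)) ->
  is_derive x 1 (fun e => faa_trunc phi (Y^~ e) N n) (faa_trunc phi (Y^~ x) N n.+1).
Proof.
move=> nN dphi dY; rewrite faa_truncS//.
under eq_fun do rewrite faa_truncE.
pose dc (j i : nat) : R :=
  if i is i'.+1 then Y j.+2 x / (j.+1)`!%:R * divided_power (Y^~ x) j i' else 0.
have dT (k : {ffun 'I_N -> 'I_N.+1}) : is_derive x 1
    (fun e => derive1n (\sum_(j < N) k j)%N phi (Y 0 e) * \prod_(j < N) divided_power (Y^~ e) j (k j))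
    (Y 1%N x * shifted_term phi (Y^~ x) k +
     \sum_(j < N | (0 < k j)%N) Y j.+2 x / (j.+1)`!%:R * shifted_term phi (Y^~ x) (decr_part j k)).
  have d1 : is_derive x 1 (derive1n (\sum_(j < N) k j)%N phi \o Y 0)
      (derive1n (\sum_(j < N) k j).+1 phi (Y 0 x) * Y 1%N x).
    apply: is_derive1_comp; apply: DeriveDef; first exact: dphi.
    by rewrite -derive1E.
  have d2 : is_derive x 1 (fun e => \prod_(j < N) divided_power (Y^~ e) j (k j))
      (\sum_(j < N) dc j (k j) * \prod_(i < N | i != j) divided_power (Y^~ x) i (k i)).
    rewrite -[index_enum _]/(index_enum 'I_N).
    apply: is_derive_bigprod; first exact: index_enum_uniq.
    by move=> j; apply: is_derive_divided_power.
  apply: (is_derive_eq (is_deriveM d1 d2)).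
  rewrite addrC /GRing.scale /= {1}/shifted_term; congr (_ + _).
    by rewrite [LHS]mulrC mulrAC [LHS]mulrC.
  rewrite mulr_sumr [RHS]big_mkcond; apply: eq_bigr => j _.
  case: ltnP => [kj|]; last by rewrite leqn0 /dc => /eqP ->; rewrite mul0r mulr0.
  rewrite -shifted_term_decr// /dc; case: (nat_of_ord (k j)) kj => // m _ /=.
  by ring.
have dS := @is_derive_bigsum _ (index_enum _) (fun k => weighted_degree k == n) _ _ x (fun k _ => dT k).
apply: (is_derive_eq (is_deriveZ n`!%:R dS)).
rewrite /GRing.scale /=; congr (_ * _).
rewrite big_split /= -mulr_sumr; congr (_ + _).
under [LHS]eq_bigr do rewrite big_mkcond.
rewrite exchange_big /=; apply: eq_bigr => j _.
by rewrite -big_mkcondr -mulr_sumr shifted_coefE// ltnW.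
Qed.

Lemma faa_trunc0 phi y N : faa_trunc phi y N 0 = phi (y 0).
Proof.
rewrite faa_truncE fact0 mul1r (big_pred1 [ffun=> ord0]) => [|k].
  rewrite !big1 ?mulr1 => [|j _|j _]; rewrite ?ffunE//.
  by rewrite /divided_power expr0 fact0 divr1.
rewrite /weighted_degree sum_nat_eq0; apply/idP/eqP => [/forallP k0|-> ].
  apply/ffunP => j; apply/val_inj => /=; rewrite ffunE.
  by move: (k0 j); rewrite muln_eq0 => /eqP.
by apply/forallP => j; rewrite ffunE muln0.
Qed.

(** A tuple of weight n has at most n <= N parts, and powers of 1 + V increase with the exponent,
    which gives the power N. [C] is chosen before [y], hence is uniform in the path and in the
    parameter. *)
Lemma faa_trunc_bound phi N n : (n <= N)%N ->
  exists2 C : R, 0 <= C & forall y M V, 0 <= V ->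
    (forall m, (m <= N)%N -> `|derive1n m phi (y 0)| <= M) ->
    (forall j, (j < N)%N -> `|y j.+1| <= V) ->
    `|faa_trunc phi y N n| <= C * M * (1 + V) ^+ N.
Proof.
move=> nN; pose c (k : {ffun 'I_N -> 'I_N.+1}) : R :=
  `|n`!%:R / \prod_(j < N) ((k j)`!%:R * (j.+1)`!%:R ^+ k j)|.
exists (\sum_(k : {ffun 'I_N -> 'I_N.+1} | weighted_degree k == n) c k).
  by apply: sumr_ge0 => k _; exact: normr_ge0.
move=> y M V V0 phiM yV; rewrite -mulrA mulr_suml.
apply: (le_trans (ler_norm_sum _ _ _)); apply: ler_sum => k /eqP wk.
rewrite 2!normrM -mulrA ler_wpM2l//.
have kN : (\sum_(j < N) k j <= N)%N by rewrite (leq_trans (leq_sum_weighted_degree k))// wk.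
apply: ler_pM => //; first exact: phiM.
apply: (@le_trans _ _ ((1 + V) ^+ (\sum_(j < N) k j)%N)); last first.
  by rewrite ler_weXn2l// lerDl.
rewrite normr_prod -prodrXr; apply: ler_prod => j _.
rewrite normr_ge0 normrX lerXn2r ?nnegrE//= ?addr_ge0//.
by rewrite (le_trans (yV _ _))// lerDr.
Qed.

End FaaDiBruno.

(** * The Bernoulli measure on sequences of symbols *)

Section Sequences.
Context {R : realType}.

Lemma measurable_cylinder (w : nat -> bool) n : measurable (cylinder w n : set Sigma).
Proof. by apply: sub_sigma_algebra; exists w, n. Qed.

(** The event is the finite union of the cylinders over the words of length k + 1 that end in
    [b]. *)
Lemma measurable_symbol k b : measurable [set s : Sigma | s k = b].
Proof.
rewrite (_ : [set s : Sigma | s k = b] =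
    \bigcup_(w in [set w : k.+1.-tuple bool | nth false w k = b]) cylinder (nth false w) k.+1).
  by apply: fin_bigcup_measurable => // w _; exact: measurable_cylinder.
apply/seteqP; split=> [s /= skb|s [w /= wkb] /(_ k (ltnSn k)) ->//].
have sE i : (i < k.+1)%N -> nth false [tuple s (val i) | i < k.+1] i = s i.
  by move=> ik; rewrite -(tnth_nth _ _ (Ordinal ik)) tnth_mktuple.
exists [tuple s (val i) | i < k.+1]; first by rewrite /= sE.
by move=> i ik; rewrite sE.
Qed.

Definition flip (k : nat) (s : Sigma) : Sigma := fun i => if i == k then ~~ s i else s i.

Lemma flip_cylinder k w n : flip k @^-1` cylinder w n = cylinder (flip k w) n.
Proof.
by apply/seteqP; split=> s H i /H; rewrite /flip/=; case: eqP => // _ /(congr1 negb); rewrite negbK.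
Qed.

Lemma measurable_flip k : measurable_fun setT (flip k).
Proof.
apply: (@measurability _ _ _ _ setT (flip k) cylinders) => // _ [_ [w [n ->]] <-].
by rewrite setTI flip_cylinder; exact: measurable_cylinder.
Qed.

Variable nu : probability Sigma R.
Hypothesis nu_half : bernoulli_half nu.

(** Flipping a symbol carries a cylinder to a cylinder of the same length, so both measures agree on
    cylinders; together with the empty set these form a pi-system, which determines a finite
    measure. *)
Lemma flip_invariant k (A : set Sigma) : measurable A -> nu (flip k @^-1` A) = nu A.
Proof.
move=> mA.
pose G : set (set Sigma) := cylinders `|` [set set0].
have GE : <<s G >> = <<s cylinders >>.
  apply/seteqP; split.
    apply: smallest_sub; first exact: smallest_sigma_algebra.
    move=> B [H|->]; first exact: sub_sigma_algebra.
    exact: (@measurable0 _ Sigma).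
  apply: smallest_sub; first exact: smallest_sigma_algebra.
  by move=> B GB; apply: sub_sigma_algebra; left.
rewrite -[LHS]/(pushforward nu (flip k) A).
have cylI w n w' n' : cylinder w n `&` cylinder w' n' = set0 \/
    exists v m, cylinder w n `&` cylinder w' n' = cylinder v m.
  have [->|/set0P[v [vw vw']]] := eqVneq (cylinder w n `&` cylinder w' n') set0.
    by left.
  (* Any common point [v] describes the intersection as a cylinder of the larger length. *)
  right; exists v, (maxn n n'); apply/seteqP; split=> s.
    case=> sw sw' i.
    by rewrite leq_max => /orP[i_n|i_n]; [rewrite sw ?vw|rewrite sw' ?vw'].
  by move=> sv; split => i i_n; rewrite sv ?leq_max ?i_n ?orbT//; [exact: vw|exact: vw'].
pose f : {mfun Sigma >-> Sigma} := HB.pack (flip k) (isMeasurableFun.Build _ _ _ _ _ (measurable_flip k)).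
apply: (@measure_unique _ R Sigma G (fun=> setT) _ _ _ _ (pushforward nu f) nu) => //.
- move=> _ _ [[w [n ->]]|->] [[w' [n' ->]]|->]; rewrite ?set0I ?setI0; [|by right..].
  by have [->|[v [m ->]]] := cylI w n w' n'; [right|left; exists v, m].
- move=> _; left; exists xpredT, 0%N; apply/seteqP; split => // s _ i; rewrite ltn0//.
- by rewrite bigcup_const.
- move=> _ [[w [n ->]]|->]; last by rewrite !measure0.
  rewrite -[LHS]/(nu (flip k @^-1` cylinder w n)) flip_cylinder.
  exact: (etrans (nu_half _ _) (esym (nu_half _ _))).
- move=> _; apply: le_lt_trans (ltry 1); rewrite -[leLHS]/(nu (flip k @^-1` setT)).
  by apply: probability_le1; rewrite preimage_setT.
Qed.


Lemma Rintegral_flip k (f : Sigma -> R) (M : R) : measurable_fun setT f ->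
  (forall s, `|f s| <= M) -> (\int[nu]_s f s = \int[nu]_s f (flip k s))%R.
Proof.
move=> mf fM; rewrite /Rintegral; congr fine.
pose g : {mfun Sigma >-> Sigma} :=
  HB.pack (flip k) (isMeasurableFun.Build _ _ _ _ _ (measurable_flip k)).
transitivity (\int[pushforward nu g]_s (f s)%:E)%E.
  by apply: eq_measure_integral => A mA _; exact/esym/flip_invariant.
rewrite (@integral_pushforward _ _ Sigma Sigma R g _ nu setT (EFin \o f))//.
- exact/measurable_EFinP.
- apply: (@integrable_bounded _ _ _ nu (f \o g) M) => //.
  exact: measurableT_comp.
by move=> s; exact: fM.
Qed.

Lemma measurable_choice k (f g : Sigma -> R) :
  measurable_fun setT f -> measurable_fun setT g ->
  measurable_fun setT (fun s : Sigma => if s k then f s else g s).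
Proof.
apply: measurable_fun_ifT => //; apply: (measurable_fun_bool true).
by rewrite setTI; exact: measurable_symbol.
Qed.

(* The k-th symbol is independent of what does not depend on it, because
   flipping it preserves nu. *)
Lemma Rintegral_choice k (f : bool -> Sigma -> R) (M : R) :
  (forall b, measurable_fun setT (f b)) -> (forall b s, `|f b s| <= M) ->
  (forall b s, f b (flip k s) = f b s) ->
  ((\int[nu]_s f (s k) s) = (\int[nu]_s f true s + \int[nu]_s f false s) / 2)%R.
Proof.
move=> mf fM fk.
have mfE (h : bool -> bool) : measurable_fun setT (fun s : Sigma => f (h (s k)) s).
  rewrite (_ : (fun s => _) = fun s : Sigma => if s k then f (h true) s else f (h false) s).
    exact: measurable_choice.
  by apply/funext => s; case: (s k).
have -> : \int[nu]_s f true s + \int[nu]_s f false s =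
    \int[nu]_s f (s k) s + \int[nu]_s f (~~ (s k)) s.
  rewrite -!RintegralD//; last 4 first.
  - by apply: (@integrable_bounded _ _ _ nu _ M) => //; exact: (mfE id).
  - by apply: (@integrable_bounded _ _ _ nu _ M) => //; exact: (mfE negb).
  - exact: (@integrable_bounded _ _ _ nu _ M).
  - exact: (@integrable_bounded _ _ _ nu _ M).
  by apply: eq_Rintegral => s _; case: (s k); rewrite //= addrC.
rewrite [X in _ + X](_ : _ = \int[nu]_s f (s k) s); first by field.
rewrite (@Rintegral_flip k _ M) ?(mfE negb)//.
by apply: eq_Rintegral => s _; rewrite fk /flip eqxx negbK.
Qed.

Lemma weightS (a b : R) s m : weight a b s m.+1 = weight a b s m * symb a b (s m).
Proof. by rewrite /weight big_nat_recr. Qed.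

Lemma weight_flip (a b : R) k s m : (m <= k)%N -> weight a b (flip k s) m = weight a b s m.
Proof.
move=> mk; rewrite /weight !big_mkord; apply: eq_bigr => i _.
by rewrite /flip ltn_eqF// (leq_trans (ltn_ord i)).
Qed.

Lemma measurable_weight (a b : R) m : measurable_fun setT (fun s => weight a b s m).
Proof.
elim: m => [|m IH].
  rewrite (_ : (fun s => _) = cst 1); first exact: measurable_cst.
  by apply/funext => s; rewrite /weight big_geq.
rewrite (_ : (fun s => _) = fun s : Sigma => weight a b s m * symb a b (s m)).
  by apply: measurable_funM => //; apply: measurable_choice; exact: measurable_cst.
by apply/funext => s; rewrite weightS.
Qed.

Lemma weight_ge0 (a b : R) s m : 0 <= a -> 0 <= b -> 0 <= weight a b s m.
Proof. by move=> a0 b0; apply: prodr_ge0 => i _; case: (s i). Qed.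

Lemma weight_gt0 (a b : R) s m : 0 < a -> 0 < b -> 0 < weight a b s m.
Proof. by move=> a0 b0; apply: prodr_gt0 => i _; case: (s i). Qed.

Lemma weight_le (a b a' b' : R) s m : 0 <= a <= a' -> 0 <= b <= b' ->
  weight a b s m <= weight a' b' s m.
Proof. by move=> a0 b0; apply: ler_prod => i _; case: (s i). Qed.

Lemma weight_bound (a b : R) s m : 0 <= a -> 0 <= b -> weight a b s m <= (a + b) ^+ m.
Proof.
move=> a0 b0; rewrite (@le_trans _ _ (weight (a + b) (a + b) s m))//.
  by apply: weight_le; apply/andP; split => //; rewrite (lerDl,lerDr).
rewrite /weight big_mkord -[X in _ ^+ X]card_ord -prodr_const.
by apply: ler_prod => i _; rewrite /symb if_same lexx addr_ge0.
Qed.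

(** The symbol [s m] does not enter [weight a b s m], so each further factor multiplies the
    expectation by (a + b) / 2. *)
Lemma expectation_weight (a b : R) m : 0 <= a -> 0 <= b ->
  (\int[nu]_s weight a b s m = ((a + b) / 2) ^+ m)%R.
Proof.
move=> a0 b0; elim: m => [|m IH].
  under eq_Rintegral do rewrite /weight big_geq//.
  rewrite Rintegral_cst// expr0 mul1r -[RHS]/(fine 1%:E); congr fine.
  exact: probability_setT.
under eq_Rintegral do rewrite weightS.
have wM b' s : `|weight a b s m * symb a b b'| <= (a + b) ^+ m * (a + b).
  rewrite normrM; apply: ler_pM => //.
    by rewrite ger0_norm ?weight_ge0 ?weight_bound.
  by case: b' => /=; rewrite ger0_norm ?lerDl ?lerDr.
rewrite (@Rintegral_choice m (fun b' s => weight a b s m * symb a b b') _ _ wM)/=.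
- have iw : nu.-integrable setT (EFin \o (fun s => weight a b s m)).
    apply: (@integrable_bounded _ _ _ nu _ ((a + b) ^+ m)) => [|s]; first exact: measurable_weight.
    by rewrite ger0_norm ?weight_ge0 ?weight_bound.
  by rewrite !RintegralZr// IH -mulrDr exprSr mulrA.
- by move=> b'; apply: measurable_funM => //; exact: measurable_weight.
- by move=> b' s; rewrite weight_flip.
Qed.

End Sequences.

(** * Term by term derivation of dominated series *)

Section TermwiseDerivation.
Context {R : realType}.
Implicit Types (u B : R^nat).

Lemma cvg_series_dominated u B : (forall m, `|u m| <= B m) -> cvgn (series B) ->
  cvgn (series u).
Proof.
move=> uB cB; apply: (@normed_cvg _ R^o); apply: series_le_cvg cB => //= m.
exact: le_trans (normr_ge0 _) (uB m).
Qed.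

Lemma lim_series_dominated u B : (forall m, `|u m| <= B m) -> cvgn (series B) ->
  `|limn (series u)| <= limn (series B).
Proof.
move=> uB cB; have cu : cvgn [normed series u].
  by apply: series_le_cvg cB => //= m; exact: le_trans (normr_ge0 _) (uB m).
by rewrite (le_trans (@lim_series_norm _ R^o _ cu))// lim_series_le.
Qed.

Lemma eseries_EFin u : cvgn (series u) -> (\sum_(k <oo) (u k)%:E)%E = (limn (series u))%:E.
Proof.
move=> cu; rewrite -EFin_lim//; congr (limn _); apply/funext => n /=.
by rewrite sumEFin.
Qed.

Lemma integrable_count u B : (forall m, `|u m| <= B m) -> cvgn (series B) ->
  (@counting nat R).-integrable setT (EFin \o u).
Proof.
move=> uB cB; apply/integrableP; split => //.
have cu : cvgn [normed series u].
  by apply: series_le_cvg cB => //= m; exact: le_trans (normr_ge0 _) (uB m).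
rewrite ge0_integral_count//=.
by rewrite -[ltLHS]/(\sum_(k <oo) (`|u k|)%:E)%E (eseries_EFin cu) ltry.
Qed.

Lemma Rintegral_count u B : (forall m, `|u m| <= B m) -> cvgn (series B) ->
  (\int[counting]_m u m)%R = limn (series u).
Proof.
move=> uB cB; have cu := cvg_series_dominated uB cB.
rewrite /Rintegral integral_count ?eseries_EFin//.
have /integrableP[_] := integrable_count uB cB.
by rewrite ge0_integral_count// /summable -nneseries_esumT.
Qed.

Lemma near_itvoo (a b x : R) : a < x < b -> \forall y \near x, a < y < b.
Proof.
move=> axb; have : x \in `]a, b[%R by rewrite in_itv.
by move/near_in_itvoo; apply: filterS => y; rewrite in_itv.
Qed.

(* Differentiation under the integral sign for the counting measure. *)
Lemma is_derive_series (f g : nat -> R -> R) B (a b x : R) : a < x < b ->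
  (forall m y, a < y < b -> is_derive y 1 (f m) (g m y)) ->
  (forall m y, a < y < b -> `|f m y| <= B m) ->
  (forall m y, a < y < b -> `|g m y| <= B m) -> cvgn (series B) ->
  is_derive x 1 (fun y => limn (series (f^~ y))) (limn (series (g^~ x))).
Proof.
move=> xab dfg fB gB cB.
have abE y : `]a, b[%classic y -> a < y < b by rewrite /= in_itv.
have Ix : `]a, b[%classic x by rewrite /= in_itv.
have d1E m y : a < y < b -> partial1of2 (fun y m => f m y) y m = g m y.
  by move=> yab; rewrite partial1of2E; have [_ ->] := dfg m y yab.
have intf y : `]a, b[%classic y -> (@counting nat R).-integrable setT (EFin \o f^~ y).
  by move=> /abE yab; apply: (integrable_count (B := B)) => // m; exact: fB.
have B0 m : 0 <= B m by exact: le_trans (normr_ge0 _) (fB m x xab).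
have intB : (@counting nat R).-integrable setT (EFin \o B).
  by apply: (integrable_count (B := B)) => // m; rewrite ger0_norm.
have der y m : `]a, b[%classic y -> setT m -> derivable (f m) y 1.
  by move=> /abE yab _; have [] := dfg m y yab.
have gub y m : `]a, b[%classic y -> setT m -> `|partial1of2 (fun y m => f m y) y m| <= B m.
  by move=> /abE yab _; rewrite d1E// gB.
have FE y : a < y < b -> (\int[counting]_m f m y)%R = limn (series (f^~ y)).
  by move=> yab; rewrite (Rintegral_count (B := B))// => m; exact: fB.
apply: (near_eq_is_derive (f := fun y => (\int[counting]_m f m y)%R)).
  by near do apply: FE; exact: near_itvoo.
apply: DeriveDef.
  exact: (@derivable_under_integral R _ nat (@counting nat R)
  (fun y m => f m y) setT measurableT x a b Ix intf der B B0 intB gub).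
rewrite -derive1E (@differentiation_under_integral R _ nat (@counting nat R)
  (fun y m => f m y) setT measurableT x a b Ix intf der B B0 intB gub).
rewrite (Rintegral_count (B := B)) => [|m|//]; last by rewrite d1E// gB.
by congr (limn (series _)); apply/funext => m; rewrite d1E.
Unshelve. all: by end_near. Qed.

End TermwiseDerivation.

(** * Polynomials against geometric sequences *)

Section PolynomialGeometric.
Context {R : realType}.

(** With 1 / rho = 1 + h, Bernoulli's inequality gives rho^(-m) >= 1 + m h, and (1 + 1 / h) (1 + m
    h) >= m + 1. *)
Lemma bounded_linear_geometric (rho : R) : 0 < rho < 1 ->
  exists2 K, 0 <= K & forall m, m.+1%:R * rho ^+ m <= K.
Proof.
move=> /andP[r0 r1]; pose h := rho^-1 - 1.
have h0 : 0 < h by rewrite subr_gt0 invf_gt1.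
exists (1 + h^-1); first by rewrite addr_ge0// invr_ge0 ltW.
move=> m; rewrite -ler_pdivlMr ?exprn_gt0// -exprVn.
have bern : 1 + m%:R * h <= rho^-1 ^+ m.
  rewrite -[rho^-1](subrKC 1) -/h; elim: m => [|m IH]; first by rewrite mul0r addr0 expr0.
  rewrite exprS (le_trans _ (ler_wpM2l _ IH))//; last by rewrite addr_ge0// ltW.
  rewrite -natr1; have : 0 <= m%:R * h * h by rewrite !mulr_ge0// ltW.
  by lra.
apply: le_trans (ler_wpM2l _ bern); last by rewrite addr_ge0// invr_ge0 ltW.
have -> : (1 + h^-1) * (1 + m%:R * h) = 1 + h * m%:R + h^-1 + m%:R.
  by field; rewrite gt_eqF.
rewrite -natr1.
have : 0 <= h * m%:R by rewrite mulr_ge0// ltW.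
have : 0 <= h^-1 by rewrite invr_ge0 ltW.
by lra.
Qed.

(** For r between rho and 1, the ratio rho / r absorbs one factor m + 1 and r the remaining j, by
    induction. *)
Lemma bounded_poly_geometric j (rho : R) : 0 < rho < 1 ->
  exists2 K, 0 <= K & forall m, m.+1%:R ^+ j * rho ^+ m <= K.
Proof.
elim: j rho => [rho /andP[r0 r1]|j IH rho /andP[r0 r1]].
  by exists 1 => // m; rewrite mul1r exprn_ile1// ltW.
pose r := (1 + rho) / 2.
have r_gt : rho < r by rewrite /r; lra.
have r_lt1 : r < 1 by rewrite /r; lra.
have r_gt0 : 0 < r by exact: lt_trans r_gt.
have [|K K0 KP] := IH r; first by rewrite r_gt0.
have [|K' K0' KP'] := @bounded_linear_geometric (rho / r).
  by rewrite divr_gt0//= ltr_pdivrMr// mul1r.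
exists (K * K'); first exact: mulr_ge0.
move=> m; have -> : m.+1%:R ^+ j.+1 * rho ^+ m =
    (m.+1%:R ^+ j * r ^+ m) * (m.+1%:R * (rho / r) ^+ m).
  by rewrite mulrACA -exprMn mulrCA divff ?gt_eqF// mulr1 -exprSr.
have rr0 : 0 <= rho / r by apply: divr_ge0; exact: ltW.
by apply: ler_pM => //; rewrite mulr_ge0// exprn_ge0// ltW.
Qed.

Lemma cvg_poly_geometric j (rho : R) : 0 < rho < 1 ->
  cvgn (series (fun m => m.+1%:R ^+ j * rho ^+ m)).
Proof.
move=> /andP[r0 r1]; pose r := (1 + rho) / 2.
have r_gt : rho < r by rewrite /r; lra.
have r_lt1 : r < 1 by rewrite /r; lra.
have r_gt0 : 0 < r by exact: lt_trans r_gt.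
have [|K K0 KP] := @bounded_poly_geometric j (rho / r).
  by rewrite divr_gt0//= ltr_pdivrMr// mul1r.
apply: (@series_le_cvg _ _ (geometric K r)) => [m|m|m|].
- by rewrite mulr_ge0// exprn_ge0// ltW.
- by rewrite mulr_ge0// exprn_ge0// ltW.
- rewrite /geometric /= -ler_pdivrMr ?exprn_gt0// -mulrA -expr_div_n.
  exact: KP.
- by apply: is_cvg_geometric_series; rewrite ger0_norm// ltW.
Qed.

End PolynomialGeometric.

(** * The derivatives of X along a fixed sequence *)

Section Pathwise.
Context {R : realType}.
Implicit Types (s : Sigma) (a b x : R).

Lemma onesS s m : ones s m.+1 = (ones s m + s m)%N.
Proof. by rewrite /ones big_nat_recr. Qed.

Lemma ones_le s m : (ones s m <= m)%N.
Proof.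
elim: m => [|m IH]; first by rewrite /ones big_geq.
by rewrite onesS -[m.+1]addn1 leq_add//; case: (s m).
Qed.

Lemma weight_ones a b s m : weight a b s m = a ^+ ones s m * b ^+ (m - ones s m).
Proof.
elim: m => [|m IH]; first by rewrite /weight /ones !big_geq// mulr1.
rewrite weightS IH onesS; case: (s m) => /=.
  by rewrite addn1 subSS exprSr mulrAC.
by rewrite addn0 subSn ?ones_le// exprSr mulrA.
Qed.

(** The j-th derivative in x, divided by j!, of the m-th term of X with contraction ratio x. For
    [ones s m < j] the binomial coefficient vanishes, so the truncated exponent is harmless. *)
Definition Xterm (d1 d2 : R) b s j m x : R :=
  symb d1 d2 (s m) * 'C(ones s m, j)%:R * b ^+ (m - ones s m) * x ^+ (ones s m - j).

Lemma is_derive_Xterm (d1 d2 : R) b s j m x :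
  is_derive x 1 (Xterm d1 d2 b s j m) (j.+1%:R * Xterm d1 d2 b s j.+1 m x).
Proof.
rewrite [X in is_derive _ _ X _](_ : _ = (symb d1 d2 (s m) * 'C(ones s m, j)%:R *
  b ^+ (m - ones s m)) \*: (@id R ^+ (ones s m - j))); last by apply/funext => y; rewrite !fctE.
apply: is_derive_eq.
rewrite /GRing.scale /= mulr1 /Xterm subnS.
transitivity (symb d1 d2 (s m) * b ^+ (m - ones s m) * x ^+ (ones s m - j).-1 *
   ((ones s m - j) * 'C(ones s m, j))%:R); first by rewrite natrM; ring.
by rewrite -mul_bin_left natrM; ring.
Qed.

Lemma XtermE (d1 d2 : R) b s j m x : x != 0 ->
  Xterm d1 d2 b s j m x = (x ^+ j)^-1 * (weight x b s m * symb d1 d2 (s m) * 'C(ones s m, j)%:R).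
Proof.
move=> x0; rewrite /Xterm weight_ones.
have [jo|jo] := leqP j (ones s m); last by rewrite bin_small// !(mulr0,mul0r).
rewrite -[in x ^+ ones s m](subnK jo) exprD; field.
by rewrite expf_neq0.
Qed.

Lemma leq_expn_base (m n j : nat) : (m <= n)%N -> (m ^ j <= n ^ j)%N.
Proof. by case: j => // j mn; rewrite leq_exp2r. Qed.

Lemma leq_bin_exp n j : ('C(n, j) <= n.+1 ^ j)%N.
Proof.
elim: j n => [|j IH] n; first by rewrite bin0.
case: n => [|n]; first by rewrite bin0n.
rewrite -(leq_pmul2l (ltn0Sn j)) -mul_bin_diag.
rewrite (@leq_trans (n.+2 * n.+2 ^ j))//.
  by rewrite leq_mul// (leq_trans (IH n))// leq_expn_base.
by rewrite -expnS leq_pmull.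
Qed.

(** The binomial coefficient is at most (m + 1)^j, and the lower end [a1] controls the factor x^(-j)
    uniformly. *)
Lemma Xterm_bound (d1 d2 a1 : R) b s j m x : 0 < a1 <= x -> 0 < b ->
  `|Xterm d1 d2 b s j m x| <= (`|d1| + `|d2|) / a1 ^+ j * (m.+1%:R ^+ j * weight x b s m).
Proof.
move=> /andP[a10 a1x] b0; have x0 : 0 < x by exact: lt_le_trans a1x.
have w0 : 0 <= weight x b s m by rewrite weight_ge0 ?ltW.
have xj0 : 0 <= x ^+ j by rewrite exprn_ge0// ltW.
rewrite XtermE ?gt_eqF// !normrM normfV (ger0_norm xj0) (ger0_norm w0) normr_nat.
have dD : `|symb d1 d2 (s m)| <= `|d1| + `|d2|.
  by case: (s m) => /=; rewrite ?lerDl ?lerDr.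
have cm : 'C(ones s m, j)%:R <= m.+1%:R ^+ j :> R.
  by rewrite -natrX ler_nat (leq_trans (leq_bin_exp _ _))// leq_expn_base// ltnS ones_le.
have xa : (x ^+ j)^-1 <= (a1 ^+ j)^-1.
  by rewrite lef_pV2 ?posrE ?exprn_gt0// lerXn2r// ?nnegrE ltW.
rewrite [leRHS](_ : _ = (a1 ^+ j)^-1 * (weight x b s m * (`|d1| + `|d2|) * m.+1%:R ^+ j)).
  apply: ler_pM => //; first by rewrite invr_ge0 exprn_ge0// ltW.
    by rewrite !mulr_ge0.
  apply: ler_pM => //; first by rewrite mulr_ge0.
  exact: ler_wpM2l.
by ring.
Qed.


Definition Xjet (d1 d2 : R) b s j x : R := j`!%:R * limn (series (fun m => Xterm d1 d2 b s j m x)).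

Definition jet_const (d1 d2 a1 k : R) j : R :=
  (`|d1| + `|d2|) / a1 ^+ j * limn (series (fun m => m.+1%:R ^+ j * k ^+ m)).

Section decay.
Variables (d1 d2 a1 b k : R) (s : Sigma).
Hypotheses (b0 : 0 < b) (a10 : 0 < a1) (k01 : 0 < k < 1).

Let bd j M m : R := (`|d1| + `|d2|) / a1 ^+ j * (m.+1%:R ^+ j * (M * k ^+ m)).

Let bdE j M : bd j M = ((`|d1| + `|d2|) / a1 ^+ j * M) *: (fun m => m.+1%:R ^+ j * k ^+ m).
Proof.
apply/funext => m; rewrite /bd.
by transitivity ((`|d1| + `|d2|) / a1 ^+ j * M * (m.+1%:R ^+ j * k ^+ m)); first ring.
Qed.

Let cvg_bd j M : cvgn (series (bd j M)).
Proof. by rewrite bdE; apply: is_cvg_seriesZ; exact: cvg_poly_geometric. Qed.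

Let Xterm_bd j M x m : a1 <= x -> weight x b s m <= M * k ^+ m ->
  `|Xterm d1 d2 b s j m x| <= bd j M m.
Proof.
move=> a1x wM; rewrite (le_trans (@Xterm_bound d1 d2 a1 b s j m x _ b0)) ?a10//.
rewrite ler_wpM2l//; last by rewrite ler_wpM2l.
by rewrite divr_ge0 ?addr_ge0// exprn_ge0// ltW.
Qed.

Lemma cvg_Xterm j M x : a1 <= x -> (forall m, weight x b s m <= M * k ^+ m) ->
  cvgn (series (fun m => Xterm d1 d2 b s j m x)).
Proof.
move=> a1x wM; apply: (cvg_series_dominated (B := bd j M)) => // m.
exact: Xterm_bd.
Qed.

Lemma Xjet_bound j M x : a1 <= x -> (forall m, weight x b s m <= M * k ^+ m) ->
  `|Xjet d1 d2 b s j x| <= j`!%:R * jet_const d1 d2 a1 k j * M.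
Proof.
move=> a1x wM; rewrite normrM normr_nat -mulrA ler_wpM2l//.
apply: (@le_trans _ _ (limn (series (bd j M)))).
  by apply: lim_series_dominated => // m; exact: Xterm_bd.
rewrite bdE lim_seriesZ; last exact: cvg_poly_geometric.
by rewrite /jet_const /GRing.scale /= mulrAC.
Qed.

(** Weights increase with x, so their decay at the right end [a0] serves the whole interval. The
    majorant adds the bounds on the terms and on their derivatives, as [is_derive_series] takes a
    single one. *)
Lemma is_derive_Xjet a0 j M x : a1 < x < a0 -> (forall m, weight a0 b s m <= M * k ^+ m) ->
  is_derive x 1 (Xjet d1 d2 b s j) (Xjet d1 d2 b s j.+1 x).
Proof.
move=> a1xa0 wM.
have wxM m y : a1 < y < a0 -> weight y b s m <= M * k ^+ m.
  move=> /andP[a1y ya0]; rewrite (le_trans _ (wM m))// weight_le//.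
    by rewrite !ltW// (lt_trans a10).
  by rewrite lexx ltW.
pose B m := bd j M m + j.+1%:R * bd j.+1 M m.
have B0 i m : 0 <= bd i M m.
  case/andP: (a1xa0) => a1x _.
  by apply: le_trans (Xterm_bd i (ltW a1x) (wxM m x a1xa0)).
have cB : cvgn (series B).
  rewrite [B](_ : _ = bd j M + j.+1%:R *: bd j.+1 M)//.
  by apply: is_cvg_seriesD => //; exact: is_cvg_seriesZ.
have := @is_derive_series _ (Xterm d1 d2 b s j) (fun m y => j.+1%:R * Xterm d1 d2 b s j.+1 m y)
  B a1 a0 x a1xa0 _ _ _ cB.
have -> : limn (series (fun m => j.+1%:R * Xterm d1 d2 b s j.+1 m x)) =
    j.+1%:R * limn (series (fun m => Xterm d1 d2 b s j.+1 m x)).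
  rewrite -[RHS]lim_seriesZ//; apply: (@cvg_Xterm _ M).
    by case/andP: a1xa0 => /ltW.
  by move=> m; exact: wxM.
move=> H; apply: (is_derive_eq (is_deriveZ j`!%:R (H _ _ _))).
- by move=> m y _; exact: is_derive_Xterm.
- move=> m y ya; rewrite (@le_trans _ _ (bd j M m))//.
    by rewrite Xterm_bd ?wxM//; case/andP: ya => /ltW.
  by rewrite lerDl mulr_ge0.
- move=> m y ya; rewrite normrM normr_nat (@le_trans _ _ (j.+1%:R * bd j.+1 M m))//.
    by rewrite ler_wpM2l// Xterm_bd ?wxM//; case/andP: ya => /ltW.
  by rewrite lerDr.
- by rewrite /Xjet /GRing.scale /= factS natrM mulrCA mulrA.
Qed.

End decay.

Lemma Xjet0 (d1 d2 : R) b s x : x != 0 -> Xjet d1 d2 b s 0 x = Xsum d1 d2 x b s.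
Proof.
move=> x0; rewrite /Xjet fact0 mul1r /Xsum; congr (limn _); apply/funext => n.
by apply: eq_bigr => m _; rewrite XtermE// bin0 expr0 invr1 mul1r mulr1.
Qed.

Lemma XjetS (d1 d2 : R) b s j x : x != 0 ->
  cvgn (series (fun m => Xterm d1 d2 b s j.+1 m x)) ->
  Xjet d1 d2 b s j.+1 x = Xder d1 d2 x b j.+1 s.
Proof.
move=> x0 cX; rewrite /Xjet /Xder -mulrA; congr (_ * _).
pose u m := weight x b s m * symb d1 d2 (s m) * 'C(ones s m, j.+1)%:R.
have uE : (fun m => Xterm d1 d2 b s j.+1 m x) = (x ^+ j.+1)^-1 *: u.
  by apply/funext => m; rewrite XtermE.
have cu : cvgn (series u).
  rewrite (_ : u = x ^+ j.+1 *: (fun m => Xterm d1 d2 b s j.+1 m x)).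
    exact: is_cvg_seriesZ.
  by rewrite uE scalerA divff ?expf_neq0// scale1r.
rewrite uE lim_seriesZ// /GRing.scale /=; congr (_ * _).
congr (limn _); apply/funext => n.
(* The term m = 0 vanishes, because no symbol has been read and C(0, j + 1) = 0; hence the series of
   [Xder] may begin at 1. *)
case: n => [|n]; first by rewrite /series /= !big_geq.
rewrite /series /= big_ltn// [u 0]/u /ones big_geq// bin0n mulr0 add0r.
by [].
Qed.

End Pathwise.

(** * All the products are bounded in terms of |X| *)

Section WeightBound.
Context {R : realType}.
Variables (d1 d2 x b k M : R) (s : Sigma).
Hypotheses (b1 : 1 < b) (x0 : 0 < x) (k01 : 0 < k < 1).
Hypothesis wM : forall m, weight x b s m <= M * k ^+ m.

Let W := weight x b s.
Let b0 : 0 < b. Proof. exact: lt_trans b1. Qed.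
Let W0 m : 0 < W m. Proof. exact: weight_gt0. Qed.

Lemma cvg_weight0 : W @ \oo --> 0.
Proof.
have k1 : `|k| < 1 by case/andP: k01 => k0 k1; rewrite ger0_norm// ltW.
apply: (@squeeze_cvgr _ _ _ _ (cst 0) (fun m => M * k ^+ m)).
- by apply: nearW => m; rewrite wM ltW.
- exact: cvg_cst.
- by rewrite -(mulr0 M); apply: cvgMr => //; exact: cvg_expr.
Qed.

Lemma cvg_Xsum :
  (fun n => \sum_(0 <= m < n) weight x b s m * symb d1 d2 (s m)) @ \oo
    --> Xsum d1 d2 x b s.
Proof.
have := @cvg_Xterm R d1 d2 x b k s b0 x0 k01 0 M x (lexx _) wM.
rewrite [X in cvgn (series X)](_ : _ = (fun m => weight x b s m * symb d1 d2 (s m)))//.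
by apply/funext => m; rewrite XtermE ?gt_eqF// bin0 expr0 invr1 mul1r mulr1.
Qed.

(* Conjugating by a translation moves the fixed point of the expanding map to
   the origin, so that X becomes a multiple of a series of positive terms. *)
Lemma Xsum_partial n (p := d2 / (1 - b)) :
  \sum_(0 <= m < n) weight x b s m * symb d1 d2 (s m) =
  p * (1 - W n) + (d1 - (1 - x) * p) * \sum_(0 <= m < n) (s m)%:R * W m.
Proof.
have pE : d2 = p * (1 - b) by rewrite /p divfK// subr_eq0 lt_eqF.
elim: n => [|n IH]; first by rewrite !big_geq// /W /weight big_geq// subrr !mulr0 addr0.
rewrite !big_nat_recr//= IH /W weightS; case: (s n) => /=; first by ring.
by rewrite pE; ring.
Qed.

(** The products grow at each symbol 2, as b > 1, so a later decrease forces a symbol 1; the first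
    one from m on ends a stretch of growth and is the witness. *)
Let later_weight n m : W (m + n) < W m -> exists2 m', s m' & W m <= W m'.
Proof.
elim: n m => [|n IH] m; first by rewrite addn0 ltxx.
case sm: (s m) => Wlt; first by exists m.
have WmS : W m <= W m.+1 by rewrite /W weightS sm /= ler_peMr// ltW.
have [|m' sm' Wm'] := IH m.+1; first by rewrite addSnnS (lt_le_trans Wlt).
by exists m' => //; exact: le_trans Wm'.
Qed.

(** The sums of the products standing before a symbol 1 increase to (X - p) / c, so each such
    product is at most this limit. Any other product is below one of these: as the products tend to
    0, a decrease must come later. *)
Lemma weight_le_Xsum m (p := d2 / (1 - b)) : d1 - (1 - x) * p != 0 ->
  W m <= (`|Xsum d1 d2 x b s| + `|p|) / `|d1 - (1 - x) * p|.
Proof.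
set c := d1 - _ => c0.
pose S n := \sum_(0 <= m < n) (s m)%:R * W m.
have SE : S = (fun n => c^-1 * ((\sum_(0 <= m < n) weight x b s m * symb d1 d2 (s m))
    - p * (1 - W n))).
  by apply/funext => n; rewrite Xsum_partial -/p -/c -/(S n) addrAC subrr add0r mulKf.
have cS : S @ \oo --> c^-1 * (Xsum d1 d2 x b s - p * (1 - 0)).
  rewrite SE; apply: cvgMr; apply: cvgB; first exact: cvg_Xsum.
  by apply: cvgMr; apply: cvgB; [exact: cvg_cst|exact: cvg_weight0].
have ndS : nondecreasing_seq S.
  apply/nondecreasing_seqP => n; rewrite /S big_nat_recr//= lerDl mulr_ge0//.
  exact: ltW.
have S_le n : S n <= (`|Xsum d1 d2 x b s| + `|p|) / `|c|.
  have cSn : cvgn S by apply/cvg_ex; eexists; exact: cS.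
  rewrite (le_trans (nondecreasing_cvgn_le ndS cSn n))// (cvg_lim _ cS)//.
  rewrite subr0 mulr1 (le_trans (ler_norm _))// normrM normfV mulrC ler_wpM2r ?invr_ge0//.
  exact: ler_normB.
have [n Wn] : exists n, W (m + n) < W m.
  have /cvgrPdist_lt/(_ _ (W0 m))[n _ Wn] := cvg_weight0.
  exists n; have := Wn (m + n)%N (leq_addl _ _).
  by rewrite sub0r normrN gtr0_norm.
have [m' sm' Wm'] := later_weight Wn.
rewrite (le_trans Wm')// (le_trans _ (S_le m'.+1))//.
rewrite /S big_nat_recr//= sm' mul1r lerDr sumr_ge0// => i _.
by rewrite mulr_ge0// ltW.
Qed.

End WeightBound.

(** * Contraction on average and the integrable sum of products *)

Section ContractionOnAverage.
Context {R : realType}.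

Lemma expR_le_inv (u : R) : u < 1 -> expR u <= (1 - u)^-1.
Proof.
move=> u1; rewrite -[u in leLHS]opprK expRN lef_pV2 ?posrE ?expR_gt0 ?subr_gt0//.
exact: expR_ge1Dx.
Qed.

(* The derivative at t = 0 of a^t + b^t is ln (a b) < 0; roots of large order
   of a and b are replaced by slightly larger rational expressions. *)
Lemma root_pair (a b : R) : 0 < a -> 0 < b -> a * b < 1 ->
  exists al be (q : nat), [/\ 0 < al, 0 < be & al + be < 2] /\
    [/\ (0 < q)%N, a <= al ^+ q & b <= be ^+ q].
Proof.
move=> a0 b0 ab1; pose u := ln a; pose v := ln b.
have uv0 : u + v < 0.
  by rewrite /u /v -lnM ?posrE// ln_lt0// ab1 mulr_gt0.
(* This size of q ensures, for t = 1 / q, that u t < 1, v t < 1 and 2 |u v| t < - (u + v). *)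
pose q := (Num.truncn (`|u| + `|v| + 2 * `|u * v| / - (u + v))).+1.
have qgt : `|u| + `|v| + 2 * `|u * v| / - (u + v) < q%:R by exact: truncnS_gt.
have q0 : 0 < q%:R :> R by rewrite ltr0n.
have uv_ge0 : 0 <= 2 * `|u * v| / - (u + v).
  by rewrite divr_ge0 ?mulr_ge0// oppr_ge0 ltW.
pose t : R := q%:R^-1; have t0 : 0 < t by rewrite invr_gt0.
have tq : q%:R * t = 1 by rewrite divff// gt_eqF.
have ut : u * t < 1.
  rewrite ltr_pdivrMr// mul1r (le_lt_trans _ qgt)//.
  by rewrite (le_trans (ler_norm u))// -addrA lerDl addr_ge0.
have vt : v * t < 1.
  rewrite ltr_pdivrMr// mul1r (le_lt_trans _ qgt)//.
  by rewrite (le_trans (ler_norm v))// addrAC lerDr addr_ge0.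
exists (1 - u * t)^-1, (1 - v * t)^-1, q; split; split => //.
- by rewrite invr_gt0 subr_gt0.
- by rewrite invr_gt0 subr_gt0.
- have h1 : 0 < 1 - u * t by rewrite subr_gt0.
  have h2 : 0 < 1 - v * t by rewrite subr_gt0.
  have -> : (1 - u * t)^-1 + (1 - v * t)^-1 =
      ((1 - u * t) + (1 - v * t)) / ((1 - u * t) * (1 - v * t)).
    by field; rewrite !gt_eqF.
  rewrite ltr_pdivrMr ?mulr_gt0//.
  have uvt : 2 * `|u * v| * t < - (u + v).
    rewrite ltr_pdivrMr//.
    have : 2 * `|u * v| / - (u + v) < q%:R.
      by rewrite (le_lt_trans _ qgt)// lerDr addr_ge0.
    by rewrite ltr_pdivrMr ?oppr_gt0// [in X in X -> _]mulrC [q%:R * _]mulrC [_ * 2]mulrC.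
  have := ler_norm (- (u * v)); rewrite normrN => uvN.
  (* Cleared of denominators, the bound by 2 on the sum of the two inverses is exactly this
     inequality. *)
  have : t * (u + v - 2 * (u * v) * t) < 0.
    rewrite pmulr_rlt0//; have := ler_wpM2r (ltW t0) uvN; lra.
  lra.
- rewrite -[leLHS](lnK (_ : a \in Num.pos)) ?posrE// -/u.
  have -> : expR u = expR (u * t) ^+ q by rewrite -expRM_natl mulrCA tq mulr1.
  apply: lerXn2r; rewrite ?nnegrE ?expR_ge0 ?invr_ge0 ?subr_ge0 ?(ltW ut)//.
  exact: expR_le_inv.
- rewrite -[leLHS](lnK (_ : b \in Num.pos)) ?posrE// -/v.
  have -> : expR v = expR (v * t) ^+ q by rewrite -expRM_natl mulrCA tq mulr1.
  apply: lerXn2r; rewrite ?nnegrE ?expR_ge0 ?invr_ge0 ?subr_ge0 ?(ltW vt)//.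
  exact: expR_le_inv.
Qed.

Variable nu : probability Sigma R.
Hypothesis nu_half : bernoulli_half nu.
Variables a b : R.
Hypotheses (a0 : 0 < a) (b0 : 0 < b) (ab2 : a + b < 2).

Definition weight_sum (s : Sigma) : \bar R := (\sum_(m <oo) (weight a b s m)%:E)%E.

Let w0 m s : 0 <= weight a b s m. Proof. by rewrite weight_ge0// ltW. Qed.

Lemma measurable_weight_sum : measurable_fun setT weight_sum.
Proof.
apply: (@ge0_emeasurable_sum _ _ _ setT (fun m s => (weight a b s m)%:E) xpredT) => [k s _ _|k _].
  by rewrite lee_fin.
by apply/measurable_EFinP; exact: measurable_weight.
Qed.

Lemma weight_sum_ge0 s : (0 <= weight_sum s)%E.
Proof. by apply: nneseries_ge0 => m _ _; rewrite lee_fin. Qed.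

(** By monotone convergence the expectation is a geometric series of ratio (a + b) / 2 < 1. *)
Lemma integrable_weight_sum : nu.-integrable setT weight_sum.
Proof.
apply/integrableP; split; first exact: measurable_weight_sum.
under eq_integral do rewrite gee0_abs ?weight_sum_ge0//.
rewrite integral_nneseries//; last 2 first.
- by move=> m; apply/measurable_EFinP; exact: measurable_weight.
- by move=> m s _; rewrite lee_fin.
pose r := (a + b) / 2.
have r01 : 0 <= r < 1 by rewrite divr_ge0 ?addr_ge0 ?(ltW a0) ?(ltW b0)//= ltr_pdivrMr// mul1r.
rewrite (eq_eseriesr (g := fun m => (r ^+ m)%:E)) => [|m _].
  rewrite (@eseries_EFin _ (fun m => r ^+ m)) ?ltry//.
  rewrite [X in series X](_ : _ = geometric 1 r).
    by apply: is_cvg_geometric_series; case/andP: r01 => r0 r1; rewrite ger0_norm.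
  by apply/funext => m; rewrite /geometric /= mul1r.
rewrite -(expectation_weight nu_half) ?(ltW a0) ?(ltW b0)// fineK//.
apply: integrable_fin_num => //.
apply: (@integrable_bounded _ _ _ _ _ ((a + b) ^+ m)) => [|s]; first exact: measurable_weight.
by rewrite ger0_norm ?weight_bound// ltW.
Qed.

(** The event of full measure on which all pathwise statements hold. *)
Definition summable_weights := [set s : Sigma | weight_sum s \is a fin_num].

Lemma measurable_summable_weights : measurable summable_weights.
Proof.
rewrite -[X in measurable X]setTI.
exact: (emeasurable_fin_num _ measurable_weight_sum).
Qed.

Lemma summable_weights_full : nu (~` summable_weights) = 0%E.
Proof.
apply/negligibleP; first by apply: measurableC; exact: measurable_summable_weights.
have := integrable_ae measurableT integrable_weight_sum.
by apply: negligibleS => s ns h; apply: ns; exact: h.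
Qed.

Lemma weight_le_sum s m : summable_weights s -> weight a b s m <= fine (weight_sum s).
Proof.
move=> Gs; rewrite -lee_fin fineK//.
rewrite /weight_sum (nneseries_split 0 m.+1) ?add0n => [|i _]; last by rewrite lee_fin.
rewrite big_mkord big_ord_recr /=.
rewrite -[leLHS]add0e -[leLHS]adde0 leeD//.
  by rewrite leeD// sume_ge0// => i _; rewrite lee_fin.
by apply: nneseries_ge0 => i _ _; rewrite lee_fin.
Qed.

End ContractionOnAverage.

(** * The stationary measure is the law of X *)

Section StationaryMeasure.
Context {R : realType}.
Variables (d1 d2 a b : R).

Section iteration.
Variable mu : probability (measurableTypeR R) R.
Hypothesis mu_stat : stationary d1 d2 a b mu.

Let measurable_affine (c d : R) :
  measurable_fun setT (fun x : measurableTypeR R => c * x + d : measurableTypeR R).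
Proof. by apply: measurable_funD => //; apply: measurable_funM. Qed.

(** Stationarity is doubled: mu + mu is the sum of the two push-forwards. Additivity of the integral
    in the measure and the change of variables then apply. *)
Lemma stationary_Rintegral (f : R -> R) (M : R) :
  measurable_fun (setT : set (measurableTypeR R)) f -> (forall x, `|f x| <= M) ->
  (\int[mu]_x f x = (\int[mu]_x f (a * x + d1) + \int[mu]_x f (b * x + d2)) / 2)%R.
Proof.
move=> mf fM.
pose aff c d : {mfun measurableTypeR R >-> measurableTypeR R} :=
  HB.pack (fun x : measurableTypeR R => c * x + d : measurableTypeR R)
    (isMeasurableFun.Build _ _ _ _ _ (measurable_affine c d)).
have intf : mu.-integrable setT (EFin \o f) by exact: (integrable_bounded _ mf fM).
have mEf : measurable_fun setT (EFin \o f) by exact/measurable_EFinP.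
have intaff c d : mu.-integrable setT (EFin \o (f \o aff c d)).
  by apply: (@integrable_bounded _ _ _ _ _ M) => [|x]; [exact: (measurableT_comp mf (measurable_affine c d))|exact: fM].
have intpush c d : (distribution mu (aff c d)).-integrable setT (EFin \o f).
  exact: (integrable_pushforward (measurable_affine c d) mEf (intaff c d)).
have E : (\int[mu]_x (f x)%:E + \int[mu]_x (f x)%:E =
    \int[mu]_x (f (a * x + d1))%:E + \int[mu]_x (f (b * x + d2))%:E)%E.
  rewrite -integral_measure_add//.
  transitivity (\int[measure_add (distribution mu (aff a d1)) (distribution mu (aff b d2))]_x (f x)%:E)%E.
    apply: eq_measure_integral => A mA _.
    rewrite -[LHS]/(measure_add mu mu A) -[RHS]/(measure_add (distribution mu (aff a d1))
      (distribution mu (aff b d2)) A) !measure_addE.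
    have half_double (m x y : \bar R) : x \is a fin_num -> y \is a fin_num ->
        m = ((2^-1)%:E * x + (2^-1)%:E * y)%E -> (m + m = x + y)%E.
      move=> xf yf ->; rewrite -(fineK xf) -(fineK yf) -!EFinM -!EFinD.
      by congr EFin; lra.
    apply: half_double; [exact: fin_num_measure|exact: fin_num_measure|].
    exact: mu_stat.
  rewrite integral_measure_add//; [|exact: intpush|exact: intpush].
  congr (_ + _)%E;
    exact: (integral_pushforward (measurable_affine _ _) mEf (intaff _ _) measurableT).
have intT g : mu.-integrable setT g -> (\int[mu]_x g x)%E \is a fin_num.
  by move=> ig; exact: integrable_fin_num.
have := E; rewrite -(fineK (intT _ intf)) -(fineK (intT _ (intaff a d1))).
rewrite -(fineK (intT _ (intaff b d2))) -!EFinD => -[].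
rewrite /Rintegral => H.
by lra.
Qed.

(** The m-th iterate of the Markov operator of the iterated function system. *)
Fixpoint transfer (f : R -> R) (m : nat) (x : R) : R :=
  if m is m'.+1 then (transfer f m' (a * x + d1) + transfer f m' (b * x + d2)) / 2
  else f x.

Lemma measurable_transfer (f : R -> R) m :
  measurable_fun (setT : set (measurableTypeR R)) f ->
  measurable_fun (setT : set (measurableTypeR R)) (transfer f m).
Proof.
move=> mf; elim: m => [//|m IH] /=.
apply: measurable_funM => //; apply: measurable_funD.
  exact: (measurableT_comp IH (measurable_affine a d1)).
exact: (measurableT_comp IH (measurable_affine b d2)).
Qed.

Lemma transfer_bound (f : R -> R) (M : R) m x : (forall x, `|f x| <= M) ->
  `|transfer f m x| <= M.
Proof.
move=> fM; elim: m x => [//|m IH] x /=.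
rewrite normrM [X in _ * X]ger0_norm// ler_pdivrMr// (le_trans (ler_normD _ _))//.
by rewrite mulr_natr mulr2n lerD.
Qed.

Lemma stationary_transfer (f : R -> R) (M : R) m :
  measurable_fun (setT : set (measurableTypeR R)) f -> (forall x, `|f x| <= M) ->
  (\int[mu]_x f x = \int[mu]_x transfer f m x)%R.
Proof.
move=> mf fM; elim: m => [//|m ->] /=.
rewrite (stationary_Rintegral (measurable_transfer m mf) (fun x => transfer_bound m x fM)).
have inttr c d : mu.-integrable setT (EFin \o (fun x => transfer f m (c * x + d))).
  apply: (@integrable_bounded _ _ _ _ _ M) => [|x]; last exact: transfer_bound.
  exact: (measurableT_comp (measurable_transfer m mf) (measurable_affine c d)).
rewrite -RintegralD// -RintegralZr//.
exact: (integrableD measurableT (inttr a d1) (inttr b d2)).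
Qed.

End iteration.

Section law.
Variable nu : probability Sigma R.
Hypothesis nu_half : bernoulli_half nu.

Definition Xpartial (s : Sigma) m : R :=
  \sum_(0 <= k < m) weight a b s k * symb d1 d2 (s k).

Lemma measurable_Xpartial m : measurable_fun setT (fun s => Xpartial s m).
Proof.
apply: measurable_sum => k; apply: measurable_funM; first exact: measurable_weight.
by apply: measurable_choice; exact: measurable_cst.
Qed.

Lemma Xpartial_flip k s m : (m <= k)%N -> Xpartial (flip k s) m = Xpartial s m.
Proof.
move=> mk; rewrite /Xpartial !big_mkord; apply: eq_bigr => i _.
have ik := leq_trans (ltn_ord i) mk.
by rewrite weight_flip 1?ltnW// /flip ltn_eqF.
Qed.

(** [Xpartial s m + weight a b s m * x] is the composition of the maps of the first m symbols at x,
    the last symbol acting first. A new symbol therefore changes only the point x, and is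
    independent of the sum and the weight before it. *)
Lemma transferE (f : R -> R) (M : R) m x : (forall x, `|f x| <= M) ->
  measurable_fun (setT : set (measurableTypeR R)) f ->
  transfer f m x = (\int[nu]_s f (Xpartial s m + weight a b s m * x))%R.
Proof.
move=> fM mf; elim: m x => [|m IH] x.
  have -> : (fun s => f (Xpartial s 0 + weight a b s 0 * x)) = cst (f x).
    by apply/funext => s; rewrite /Xpartial /weight !big_geq// add0r mul1r.
  rewrite Rintegral_cst// -[LHS]mulr1 -[in LHS]/(fine 1%:E); congr (_ * fine _).
  exact/esym/probability_setT.
rewrite /= !IH.
pose F b' s := f (Xpartial s m + weight a b s m * (symb a b b' * x + symb d1 d2 b')).
have -> : (fun s => f (Xpartial s m.+1 + weight a b s m.+1 * x)) = (fun s => F (s m) s).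
  apply/funext => s; rewrite /F /Xpartial big_nat_recr//= weightS.
  by congr f; ring.
rewrite (@Rintegral_choice R nu nu_half m F M)//.
- move=> b'; apply: (measurableT_comp mf); apply: measurable_funD.
    exact: measurable_Xpartial.
  by apply: measurable_funM => //; exact: measurable_weight.
- by move=> b' s; exact: fM.
- by move=> b' s; rewrite /F Xpartial_flip// weight_flip.
Qed.

Variable mu : probability (measurableTypeR R) R.
Hypothesis mu_stat : stationary d1 d2 a b mu.
Variables (D : set Sigma).
Hypotheses (mD : measurable D) (D_full : nu (~` D) = 0%E).
Hypothesis cvg_weight : forall s, D s -> weight a b s @ \oo --> 0.
Hypothesis cvg_Xpartial : forall s, D s -> Xpartial s @ \oo --> Xsum d1 d2 a b s.

(** The iterates converge at each starting point to the integral over [nu], since the weight in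
    front of x tends to 0. Their integrals against [mu] are all equal, by stationarity, and converge
    to that same constant. *)
Lemma stationary_law (f : R -> R) (M : R) : continuous f -> (forall x, `|f x| <= M) ->
  (\int[mu]_x f x = \int[nu]_s f (Xsum d1 d2 a b s))%R.
Proof.
move=> cf fM; have mf : measurable_fun (setT : set (measurableTypeR R)) f.
  exact: continuous_measurable_fun.
have mX : measurable_fun setT (Xsum d1 d2 a b).
  by apply: measurable_limn => n; exact: measurable_Xpartial.
have cT x : transfer f m x @[m --> \oo] --> (\int[nu]_s f (Xsum d1 d2 a b s))%R.
  under eq_fun do rewrite (transferE _ _ fM mf).
  apply: (@bounded_cvg_Rintegral _ _ _ nu _ _ M D) => //.
  - move=> n; apply: (measurableT_comp mf); apply: measurable_funD.
      exact: measurable_Xpartial.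
    by apply: measurable_funM => //; exact: measurable_weight.
  - exact: (measurableT_comp mf).
  - move=> s Ds; apply: continuous_cvg; first exact: cf.
    rewrite -[Xsum _ _ _ _ _]addr0 -[X in _ + X](mul0r x); apply: cvgD.
      exact: cvg_Xpartial.
    by apply: cvgMl; exact: cvg_weight.
have : (\int[mu]_x transfer f m x)%R @[m --> \oo] -->
    (\int[mu]_x (cst (\int[nu]_s f (Xsum d1 d2 a b s)) x))%R.
  apply: (@bounded_cvg_Rintegral _ _ _ mu _ _ M setT) => //.
  - by rewrite setCT measure0.
  - by move=> n; exact: measurable_transfer.
  - by move=> n x; exact: transfer_bound.
have -> : (\int[mu]_x (cst (\int[nu]_s f (Xsum d1 d2 a b s)) x))%R =
    (\int[nu]_s f (Xsum d1 d2 a b s))%R.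
  rewrite Rintegral_cst// -[RHS]mulr1 -[in RHS]/(fine 1%:E); congr (_ * fine _).
  exact: probability_setT.
move=> /cvg_lim <-//; apply/esym/cvg_lim => //.
by under eq_fun do rewrite -(stationary_transfer mu_stat _ mf fM); exact: cvg_cst.
Qed.

End law.
End StationaryMeasure.

(** * Supports and bounds for the derivatives of a test function *)

Section TestFunctions.
Context {R : realType}.
Variable phi : R -> R.
Hypothesis phi_test : test_function phi.

Lemma continuous_derive1n m : continuous (derive1n m phi).
Proof.
move=> x; apply: differentiable_continuous; apply/derivable1_diffP.
exact: phi_test.1.
Qed.

(** One radius serves all orders: beyond it the function vanishes near each point, and so does each
    derivative in turn. *)
Lemma test_function_support : exists K : R, forall m x, K < `|x| -> derive1n m phi x = 0.
Proof.
have [K [_ KP]] := compact_bounded phi_test.2.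
(* [compact_bounded] makes every number above K a bound, whence K + 1. *)
exists (K + 1) => m.
have phi0 x : K + 1 < `|x| -> phi x = 0.
  move=> Kx; apply/eqP; apply: contraTT Kx => phix; rewrite -leNgt.
  by apply: KP; [rewrite ltrDl|exact: subset_closure].
elim: m => [|m IH] x Kx; first exact: phi0.
rewrite derive1nS derive1E (@near_eq_derive _ _ _ _ (cst 0)) ?derive_cst//.
have : \forall y \near x, K + 1 < `|y|.
  have : `|y| @[y --> x] --> `|x| by exact: norm_continuous.
  by move/cvgr_gt; apply.
by apply: filterS => y; exact: IH.
Qed.

Lemma test_function_bounded N :
  exists2 M : R, 0 <= M & forall m x, (m <= N)%N -> `|derive1n m phi x| <= M.
Proof.
have [K KP] := test_function_support.
suff bd m : exists2 M : R, 0 <= M & forall x, `|derive1n m phi x| <= M.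
  elim: N => [|N [M M0 MP]].
    have [M M0 MP] := bd 0%N; exists M => // m x; rewrite leqn0 => /eqP ->.
    exact: MP.
  have [M' M'0 MP'] := bd N.+1; exists (M + M'); first exact: addr_ge0.
  move=> m x; rewrite leq_eqVlt => /predU1P[->|mN].
    by rewrite (le_trans (MP' x))// lerDr.
  by rewrite (le_trans (MP m x mN))// lerDl.
have cK : compact `[- K, K]%classic by exact: segment_compact.
have cf : {within `[- K, K]%classic, continuous (derive1n m phi)}.
  by apply: continuous_subspaceT; exact: continuous_derive1n.
have [M [_ MP]] := compact_bounded (continuous_compact cf cK).
exists (`|M| + 1); first by rewrite addr_ge0.
move=> x; have [Kx|xK] := ltP K `|x|; first by rewrite KP// normr0 addr_ge0.
apply: MP; first by rewrite (le_lt_trans (ler_norm M))// ltrDl.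
by exists x => //=; rewrite in_itv/= -ler_norml.
Qed.

End TestFunctions.

(** * Decay of the products on the event |X| <= K *)

Section Domination.
Context {R : realType}.
Variables (l1 l2 d1 d2 : R).
Hypotheses (l1_gt0 : 0 < l1) (l2_gt1 : 1 < l2).
Let l2_gt0 : 0 < l2. Proof. exact: lt_trans l2_gt1. Qed.

Lemma weight_scale (r a b : R) s m : weight (r * a) (r * b) s m = r ^+ m * weight a b s m.
Proof.
elim: m => [|m IH]; first by rewrite /weight !big_geq// mulr1.
by rewrite !weightS IH exprS; case: (s m) => /=; ring.
Qed.

Lemma weight_exp (a b : R) q s m : weight (a ^+ q) (b ^+ q) s m = weight a b s m ^+ q.
Proof.
elim: m => [|m IH]; first by rewrite /weight !big_geq// expr1n.
by rewrite !weightS IH exprMn; case: (s m).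
Qed.

Lemma weight0 (a b : R) s : weight a b s 0 = 1.
Proof. by rewrite /weight big_geq. Qed.

Lemma exists_root (z : R) N : (0 < N)%N -> 1 <= z -> exists2 M : R, 1 <= M & M ^+ N = z.
Proof.
move=> N0 z1; have z0 : 0 <= z by rewrite (le_trans _ z1).
have zN : (z `^ N%:R^-1) ^+ N = z.
  rewrite -powR_mulrn ?powR_ge0// -powRrM mulVf ?powRr1//.
  by rewrite pnatr_eq0 -lt0n.
exists (z `^ N%:R^-1) => //.
by rewrite -(@ler_pXn2r _ N)// ?nnegrE ?powR_ge0// expr1n zN.
Qed.

Variables (al be sg : R) (q : nat) (e0 : R).
Hypotheses (al_gt0 : 0 < al) (be_gt0 : 0 < be) (sg_gt1 : 1 < sg) (q_gt0 : (0 < q)%N).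
Hypotheses (e0_gt0 : 0 < e0) (e0_lt : e0 < l1).
Hypotheses (l1_al : l1 + e0 <= al ^+ q) (l2_be : l2 <= be ^+ q).

Definition controlled (s : Sigma) (z : R) := forall m, weight (sg * al) (sg * be) s m <= z.

Let sg_gt0 : 0 < sg. Proof. exact: lt_trans sg_gt1. Qed.

Lemma controlled_ge1 s z : controlled s z -> 1 <= z.
Proof. by move=> /(_ 0); rewrite weight0. Qed.

Lemma controlled_weight s z m : controlled s z -> weight al be s m <= z * sg^-1 ^+ m.
Proof.
move=> /(_ m); rewrite weight_scale exprVn ler_pdivlMr ?exprn_gt0//.
by rewrite mulrC.
Qed.

Lemma weight_le_root x s m : 0 < x <= l1 + e0 -> weight x l2 s m <= weight al be s m ^+ q.
Proof.
move=> /andP[x0 xe0]; rewrite -weight_exp weight_le//.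
  by rewrite (ltW x0) (le_trans xe0).
by rewrite (ltW l2_gt0).
Qed.

Lemma inv_sg01 : 0 < sg^-1 < 1.
Proof. by rewrite invr_gt0 sg_gt0 invf_lt1. Qed.

(** From A <= g^q and g <= z sg^(-m). The power z^q may fail to be integrable: this bound serves the
    convergence and derivation of series on each path, while [path_decay] provides the growth that
    can be integrated. *)
Lemma controlled_decay s z x m : controlled s z -> 0 < x <= l1 + e0 ->
  weight x l2 s m <= z ^+ q * sg^-1 ^+ m.
Proof.
move=> sz xe0; rewrite (le_trans (weight_le_root s m xe0))//.
have z0 : 0 <= z by rewrite (le_trans _ (controlled_ge1 sz)).
have /andP[sV0 sV1] := inv_sg01.
apply: (@le_trans _ _ ((z * sg^-1 ^+ m) ^+ q)).
  by rewrite lerXn2r ?nnegrE ?weight_ge0 ?(ltW al_gt0) ?(ltW be_gt0) ?mulr_ge0 ?exprn_ge0 ?(ltW sV0)// controlled_weight.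
rewrite exprMn ler_wpM2l ?exprn_ge0//.
rewrite ler_iXnr// ?exprn_ge0 ?exprn_ile1 ?(ltW sV0) ?(ltW sV1)//.
Qed.

(* If A <= C and A <= g^q, then (A / C)^N <= g: either g >= 1, or g^q <= g. *)
Lemma capped_power_le (A C g : R) N : (0 < N)%N -> 0 <= A <= C -> 1 <= C -> A <= g ^+ q ->
  0 <= g -> (A / C) ^+ N <= g.
Proof.
move=> N0 /andP[A0 AC] C1 Ag g0; have C0 : 0 < C by exact: lt_le_trans C1.
have AC0 : 0 <= A / C by rewrite divr_ge0// ltW.
have AC1 : A / C <= 1 by rewrite ler_pdivrMr// mul1r.
have [g1|g1] := leP 1 g; first by rewrite (le_trans _ g1)// exprn_ile1.
rewrite (le_trans (@ler_iXnr _ _ N N0 AC0 AC1))//.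
have AA : A / C <= A by rewrite ler_pdivrMr// ler_peMr.
rewrite (le_trans AA)// (le_trans Ag)//.
by rewrite ler_iXnr// ltW.
Qed.

Variables (c0 : R).
Let p := d2 / (1 - l2).
Hypothesis c0_gt0 : 0 < c0.
Hypothesis c0_le : forall x, `|x - l1| < e0 -> c0 <= `|d1 - (1 - x) * p|.

(** Where |X| <= K all the products are at most C. Applied at the lower end a1 = l1 - dl,
    [capped_power_le] bounds the N-th power of a product over C by z sg^(-m), so the product is at
    most C M eta^m with M^N = z. Going up from a1 to x costs at most (a2 / a1)^m. *)
Lemma path_decay N K : (0 < N)%N -> exists dl tau C1 : R,
  [/\ 0 < dl, dl < e0, 0 < tau < 1, 0 <= C1 &
   forall s z x, controlled s z -> `|x - l1| < dl -> `|Xsum d1 d2 x l2 s| <= K ->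
     exists M, [/\ 1 <= M, M ^+ N = z & forall m, weight x l2 s m <= C1 * M * tau ^+ m]].
Proof.
move=> N0; have /andP[sV0 sV1] := inv_sg01.
have NR : 0 < N%:R :> R by rewrite ltr0n.
(* With this h, Bernoulli's inequality gives (1 - h)^N >= 1 - N h = 1 / sg. *)
pose h := (1 - sg^-1) / N%:R.
have h0 : 0 < h by rewrite divr_gt0// subr_gt0.
have h1 : h < 1.
  rewrite ltr_pdivrMr// mul1r (lt_le_trans (_ : _ < 1))//; last by rewrite ler1n.
  by rewrite gtrBl.
pose eta := 1 - h.
have eta0 : 0 < eta by rewrite subr_gt0.
have eta1 : eta < 1 by rewrite gtrBl.
have etaN : sg^-1 <= eta ^+ N.
  have bern n : 1 - n%:R * h <= eta ^+ n.
    elim: n => [|n IH]; first by rewrite mul0r subr0 expr0.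
    rewrite exprS (le_trans _ (ler_wpM2l (ltW eta0) IH))//.
    have h0' := ltW h0.
    have : 0 <= n%:R * h * h by apply: mulr_ge0 => //; apply: mulr_ge0.
    by rewrite -natr1 /eta; lra.
  rewrite (le_trans _ (bern N))// /h mulrCA divff ?gt_eqF// mulr1.
  by rewrite opprB addrC subrK.
(* The second bound makes (l1 + dl) eta < l1 - dl, so the final ratio (a2 / a1) eta stays below
   1. *)
pose dl := Num.min (e0 / 2) (l1 * (1 - eta) / 4).
have dl0 : 0 < dl by rewrite lt_min !divr_gt0 ?mulr_gt0// subr_gt0.
have dle0 : dl <= e0 / 2 by rewrite ge_min lexx.
have dll1 : dl <= l1 * (1 - eta) / 4 by rewrite ge_min lexx orbT.
clearbody dl eta.
have dl_lt : dl < e0.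
  by rewrite (le_lt_trans dle0)// ltr_pdivrMr// ltr_pMr// ltr1n.
have dl_l1 : dl < l1 by exact: lt_trans e0_lt.
pose a1 := l1 - dl; pose a2 := l1 + dl.
have a10 : 0 < a1 by rewrite /a1; lra.
have a20 : 0 < a2 by rewrite /a2; lra.
have tau01 : 0 < a2 / a1 * eta < 1.
  rewrite mulr_gt0 ?divr_gt0//= mulrAC ltr_pdivrMr// mul1r /a1 /a2.
  have : dl * eta <= dl by rewrite ler_piMr// ltW.
  have : 0 < l1 * (1 - eta) by rewrite mulr_gt0// subr_gt0.
  by nra.
pose C := Num.max 1 ((K + `|p|) / c0).
have C1 : 1 <= C by rewrite le_max lexx.
exists dl, (a2 / a1 * eta), C; split => //; first by rewrite (le_trans _ C1).
move=> s z x sz xdl XK.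
have z1 := controlled_ge1 sz.
have [M M1 MN] := exists_root N0 z1.
exists M; split => // m.
have /andP[xa1 xa2] : a1 < x < a2.
  by move: xdl; rewrite ltr_norml /a1 /a2 => /andP[? ?]; apply/andP; split; lra.
have x0 : 0 < x by apply: lt_trans xa1.
have xe0 : 0 < x <= l1 + e0 by rewrite x0/= ltW// (lt_trans xa2)// ltrD2l.
have wC : weight x l2 s m <= C.
  have xl1 : `|x - l1| < e0 by exact: lt_trans dl_lt.
  have c0x := c0_le xl1.
  rewrite (le_trans (@weight_le_Xsum R d1 d2 x l2 sg^-1 (z ^+ q) s l2_gt1 x0 inv_sg01
    (fun m => controlled_decay m sz xe0) m _))//.
    by rewrite -normr_gt0 (lt_le_trans c0_gt0).
  rewrite le_max; apply/orP; right; apply: ler_pM => //.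
  - by rewrite lerD2r.
  - by rewrite lef_pV2// posrE (lt_le_trans c0_gt0).
have w1C : weight a1 l2 s m <= C.
  rewrite (le_trans _ wC)// weight_le// ?(ltW l2_gt0) ?lexx//.
  by rewrite (ltW a10) ltW.
have w10 : 0 <= weight a1 l2 s m by rewrite weight_ge0 ?ltW.
have w1M : weight a1 l2 s m <= C * M * eta ^+ m.
  rewrite -mulrA mulrC -ler_pdivrMr; last by rewrite (lt_le_trans _ C1).
  have C0 : 0 <= C by rewrite (le_trans _ C1).
  have M0 : 0 <= M by rewrite (le_trans _ M1).
  rewrite -(@ler_pXn2r _ N)// ?nnegrE ?divr_ge0 ?mulr_ge0 ?exprn_ge0 ?(ltW eta0)//.
  rewrite [leRHS]exprMn MN -exprM mulnC exprM.
  apply: (@le_trans _ _ (z * sg^-1 ^+ m)).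
    apply: (le_trans _ (controlled_weight m sz)); apply: capped_power_le => //.
    - by rewrite w10.
    - apply: weight_le_root; rewrite a10 /a1 lerD2l; lra.
    - by rewrite weight_ge0 ?ltW.
  rewrite ler_wpM2l// ?(le_trans _ z1)// lerXn2r ?nnegrE ?exprn_ge0 ?(ltW eta0) ?(ltW sV0)//.
(* Both ratios are multiplied by a2 / a1 > 1: the first becomes a2 >= x and the second exceeds
   l2. *)
apply: (@le_trans _ _ (weight (a2 / a1 * a1) (a2 / a1 * l2) s m)).
  apply: weight_le; first by rewrite (ltW x0) divfK ?gt_eqF// ltW.
  rewrite (ltW l2_gt0) ler_peMl ?(ltW l2_gt0)// ler_pdivlMr// mul1r /a1 /a2; lra.
rewrite weight_scale (exprMn _ (a2 / a1) eta) [leRHS]mulrCA ler_wpM2l//.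
by rewrite exprn_ge0// divr_ge0 ?(ltW a10) ?(ltW a20).
Qed.

End Domination.

(** * Domination of the derivatives of phi o X by a multiple of z *)

Section JetDomination.
Context {R : realType}.
Variables (l1 l2 d1 d2 : R).
Hypotheses (l1_gt0 : 0 < l1) (l2_gt1 : 1 < l2).
Variables (al be sg : R) (q : nat) (e0 c0 : R).
Hypotheses (al_gt0 : 0 < al) (be_gt0 : 0 < be) (sg_gt1 : 1 < sg) (q_gt0 : (0 < q)%N).
Hypotheses (e0_gt0 : 0 < e0) (e0_lt : e0 < l1).
Hypotheses (l1_al : l1 + e0 <= al ^+ q) (l2_be : l2 <= be ^+ q).
Hypothesis c0_gt0 : 0 < c0.
Hypothesis c0_le : forall x, `|x - l1| < e0 -> c0 <= `|d1 - (1 - x) * (d2 / (1 - l2))|.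
Variable phi : R -> R.
Hypothesis phi_test : test_function phi.

(** If |X| > K, every derivative of [phi] vanishes at X. Otherwise each X^(j) is at most V0 M with M
    >= 1 and M^N = z, and the formula, of degree at most N in them, is at most a constant times (1 +
    V0 M)^N <= (1 + V0)^N z. *)
Lemma faa_dominated N : (0 < N)%N -> exists dl : R, [/\ 0 < dl, dl < e0 &
  forall n, (n <= N)%N -> exists2 C, 0 <= C &
    forall s z x, controlled al be sg s z -> `|x - l1| < dl ->
      `|faa_trunc phi ((Xjet d1 d2 l2 s)^~ x) N n| <= C * z].
Proof.
move=> N0; have [K KP] := test_function_support phi_test.
have [dl [tau [C1 [dl0 dle0 tau01 C10 decay]]]] :=
  path_decay l1_gt0 l2_gt1 al_gt0 be_gt0 sg_gt1 q_gt0 e0_gt0 e0_lt l1_al l2_be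
    c0_gt0 c0_le K N0.
exists dl; split => // n nN.
have [B B0 BP] := test_function_bounded phi_test N.
have [CF CF0 CFP] := faa_trunc_bound phi nN.
pose a1 := l1 - e0; have a10 : 0 < a1 by rewrite subr_gt0.
pose V0 := \sum_(j < N) `|(j.+1)`!%:R * jet_const d1 d2 a1 tau j.+1 * C1|.
have V00 : 0 <= V0 by rewrite sumr_ge0.
exists (CF * B * (1 + V0) ^+ N).
  by rewrite mulr_ge0 ?exprn_ge0 ?addr_ge0// mulr_ge0.
move=> s z x sz xdl; have z1 := controlled_ge1 sz.
have z0 : 0 <= z by rewrite (le_trans _ z1).
have a1x : a1 < x.
  by move: xdl; rewrite ltr_norml /a1 => /andP[xl _]; lra.
have x0 : 0 < x by exact: lt_trans a1x.
have rhs0 : 0 <= CF * B * (1 + V0) ^+ N * z.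
  by rewrite mulr_ge0// mulr_ge0 ?exprn_ge0 ?addr_ge0// mulr_ge0.
have [XK|XK] := leP `|Xsum d1 d2 x l2 s| K; last first.
  (* This bound depends on the path, but it gets multiplied by the bound 0 on the derivatives of
     [phi]. *)
  pose V := \sum_(j < N) `|Xjet d1 d2 l2 s j.+1 x|.
  have := CFP ((Xjet d1 d2 l2 s)^~ x) 0 V _ _ _.
  rewrite mulr0 mul0r => H; rewrite (le_trans (H _ _ _))//.
  - by rewrite sumr_ge0.
  - by move=> m _; rewrite Xjet0 ?gt_eqF// KP ?normr0.
  - by move=> j jN; rewrite /V (bigD1 (Ordinal jN))//= lerDl sumr_ge0.
have [M [M1 MN wM]] := decay s z x sz xdl XK.
have M0 : 0 <= M by rewrite (le_trans _ M1).
rewrite (le_trans (CFP ((Xjet d1 d2 l2 s)^~ x) B (V0 * M) _ _ _))//.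
- by rewrite mulr_ge0.
- by move=> m mN; exact: BP.
- move=> j jN; rewrite (le_trans (@Xjet_bound _ d1 d2 a1 l2 tau s _ a10 tau01 j.+1 (C1 * M) x _ _))//.
  + exact: lt_trans l2_gt1.
  + exact: ltW.
  + rewrite mulrA ler_wpM2r// /V0 (bigD1 (Ordinal jN))//= (le_trans (ler_norm _))//.
    by rewrite lerDl sumr_ge0.
- rewrite -MN -[leRHS]mulrA ler_wpM2l ?mulr_ge0// -exprMn lerXn2r ?nnegrE//.
  + by rewrite addr_ge0 ?mulr_ge0.
  + by rewrite mulr_ge0 ?addr_ge0.
  + by rewrite mulrDl mul1r lerD2r.
Qed.

End JetDomination.

(** * Iterated derivatives from a chain of derivatives, and measurability *)

Section DerivativeChains.
Context {R : realType}.

Lemma near_norm_lt (d e : R) : `|e| < d -> \forall y \near e, `|y| < d.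
Proof.
move=> ed; have : `|y| @[y --> e] --> `|e| by exact: norm_continuous.
by move/cvgr_lt; apply.
Qed.

(** By induction the n-th derivative equals [F n] on the whole ball, hence near each of its points,
    where it may be differentiated again. *)
Lemma derive1n_chain (f : R -> R) (F : nat -> R -> R) (d : R) N :
  (forall e : R, `|e| < d -> f e = F 0 e) ->
  (forall n (e : R), (n < N)%N -> `|e| < d -> is_derive e 1 (F n) (F n.+1 e)) ->
  forall n (e : R), (n <= N)%N -> `|e| < d -> derive1n n f e = F n e.
Proof.
move=> fF dF; elim=> [|n IH] e nN ed; first by rewrite derive1n0 fF.
rewrite derive1nS derive1E (@near_eq_derive _ _ _ _ (F n)).
  by have [] := dF n e nN ed.
by apply: filterS (near_norm_lt ed) => y yd; apply: IH => //; exact: ltnW.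
Qed.

Lemma derivable_chain (f : R -> R) (F : nat -> R -> R) (d : R) N :
  (forall e : R, `|e| < d -> f e = F 0 e) ->
  (forall n (e : R), (n < N)%N -> `|e| < d -> is_derive e 1 (F n) (F n.+1 e)) ->
  forall n (e : R), (n < N)%N -> `|e| < d -> derivable (derive1n n f) e 1.
Proof.
move=> fF dF n e nN ed; apply: (@near_eq_derivable _ _ _ (F n)).
  apply: filterS (near_norm_lt ed) => y yd; apply/esym.
  by apply: (derive1n_chain fF dF) => //; exact: ltnW.
by have [] := dF n e nN ed.
Qed.

(** The chain and its radius may depend on N, like the radius of domination found in
    [path_decay]. *)
Lemma smooth_at_chain (f : R -> R) :
  (forall N, exists F (d : R), [/\ 0 < d, forall e : R, `|e| < d -> f e = F 0 e &
    forall n (e : R), (n < N)%N -> `|e| < d -> is_derive e 1 (F n) (F n.+1 e)]) ->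
  smooth_at f 0.
Proof.
move=> H n; have [F [d [d0 fF dF]]] := H n.+1.
have : \forall y \near (0 : R), `|y| < d by apply: near_norm_lt; rewrite normr0.
by apply: filterS => y yd; apply: (derivable_chain fF dF).
Qed.

Lemma measurable_faa_trunc d (T : measurableType d) (phi : R -> R)
    (y : nat -> T -> R) N n : (forall m, continuous (derive1n m phi)) ->
  (forall j, measurable_fun setT (y j)) ->
  measurable_fun setT (fun s => faa_trunc phi (y^~ s) N n).
Proof.
move=> cphi my; rewrite /faa_trunc; under eq_fun do rewrite big_mkcond.
apply: measurable_sum => k; case: (weighted_degree k == n); last exact: measurable_cst.
apply: measurable_funM; last first.
  by apply: measurable_prod => j _; exact: measurable_funX.
apply: measurable_funM; first exact: measurable_cst.
apply: (measurableT_comp _ (my 0)); exact: continuous_measurable_fun.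
Qed.

(** Pascal's rule describes the effect of one more symbol 1. *)
Lemma measurable_bin_ones m j :
  measurable_fun setT (fun s : Sigma => 'C(ones s m, j)%:R : R).
Proof.
elim: m j => [|m IH] j.
  rewrite (_ : (fun s => _) = cst 'C(0, j)%:R); first exact: measurable_cst.
  by apply/funext => s; rewrite /ones big_geq.
case: j => [|j].
  rewrite (_ : (fun s => _) = cst 1); first exact: measurable_cst.
  by apply/funext => s; rewrite bin0.
rewrite (_ : (fun s => _) = fun s : Sigma =>
    if s m then 'C(ones s m, j.+1)%:R + 'C(ones s m, j)%:R else 'C(ones s m, j.+1)%:R).
  by apply: measurable_choice => //; exact: measurable_funD.
apply/funext => s; rewrite onesS; case: (s m); last by rewrite addn0.
by rewrite addn1 binS natrD.
Qed.

Lemma measurable_Xterm (d1 d2 b x : R) j m : x != 0 ->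
  measurable_fun setT (fun s => Xterm d1 d2 b s j m x).
Proof.
move=> x0; rewrite (_ : (fun s => _) = fun s : Sigma => (x ^+ j)^-1 *
    (weight x b s m * symb d1 d2 (s m) * 'C(ones s m, j)%:R)).
  apply: measurable_funM; first exact: measurable_cst.
  apply: measurable_funM; last exact: measurable_bin_ones.
  apply: measurable_funM; first exact: measurable_weight.
  by apply: measurable_choice; exact: measurable_cst.
by apply/funext => s; rewrite XtermE.
Qed.

Lemma measurable_Xjet (d1 d2 b x : R) j : x != 0 ->
  measurable_fun setT (fun s => Xjet d1 d2 b s j x).
Proof.
move=> x0; apply: measurable_funM; first exact: measurable_cst.
by apply: measurable_limn => n; apply: measurable_sum => m; exact: measurable_Xterm.
Qed.

Lemma measurable_Xder (d1 d2 a b : R) j : measurable_fun setT (Xder d1 d2 a b j).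
Proof.
apply: measurable_funM; first exact: measurable_cst.
apply: measurable_limn => n; apply: measurable_sum => m.
apply: measurable_funM; last exact: measurable_bin_ones.
apply: measurable_funM; first exact: measurable_weight.
by apply: measurable_choice; exact: measurable_cst.
Qed.

Lemma measurable_Xsum (d1 d2 a b : R) : measurable_fun setT (Xsum d1 d2 a b).
Proof.
apply: measurable_limn => n; apply: measurable_sum => m.
apply: measurable_funM; first exact: measurable_weight.
by apply: measurable_choice; exact: measurable_cst.
Qed.

End DerivativeChains.

(** * Choice of the parameters and differentiation of the integral *)

Section Main.
Context {R : realType}.
Variables (l1 l2 d1 d2 : R).
Hypotheses (l1_gt0 : 0 < l1) (l2_gt1 : 1 < l2).

Lemma parameters_exist : l1 < 1 -> l1 * l2 < 1 -> d1 / (1 - l1) != d2 / (1 - l2) ->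
  exists al be sg (q : nat) e0 c0,
  [/\ 0 < al, 0 < be, 1 < sg, (0 < q)%N & sg * al + sg * be < 2] /\
  [/\ 0 < e0, e0 < l1, l1 + e0 < 1 & (l1 + e0) * l2 < 1] /\
  [/\ l1 + e0 <= al ^+ q, l2 <= be ^+ q, 0 < c0 &
      forall x, `|x - l1| < e0 -> c0 <= `|d1 - (1 - x) * (d2 / (1 - l2))|].
Proof.
move=> l1_lt1 l12; set p := d2 / (1 - l2) => neq_fix.
have l2_gt0 : 0 < l2 by exact: lt_trans l2_gt1.
(* This is the displacement of p by the contracting map, nonzero because the fixed points differ. *)
pose c := d1 - (1 - l1) * p.
have c_neq0 : c != 0.
  apply: contra_neq neq_fix => /eqP; rewrite subr_eq0 => /eqP ->.
  by rewrite mulrC mulKf// subr_eq0 gt_eqF.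
have c_gt0 : 0 < `|c| by rewrite normr_gt0.
have p1_gt0 : 0 < 2 * (`|p| + 1) by rewrite mulr_gt0// ltr_wpDl.
(* In order, the four bounds keep l1 - e0 positive, l1 + e0 below 1, (l1 + e0) l2 below 1, and the
   displacement of p at least |c| / 2 in absolute value. *)
pose e0 := Num.min (Num.min (l1 / 2) ((1 - l1) / 2))
  (Num.min ((1 - l1 * l2) / (2 * l2)) (`|c| / (2 * (`|p| + 1)))).
have e0_gt0 : 0 < e0.
  by rewrite !lt_min !divr_gt0 ?subr_gt0 ?mulr_gt0.
have : e0 <= e0 by [].
rewrite {2}/e0 !le_min => /andP[/andP[e0_1 e0_2] /andP[e0_3 e0_4]].
clearbody e0.
have l1e0l2 : (l1 + e0) * l2 < 1.
  have : e0 * l2 <= (1 - l1 * l2) / 2.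
    by rewrite -ler_pdivlMr// -mulrA -invfM.
  by rewrite mulrDl; lra.
have l1e0_gt0 : 0 < l1 + e0 by rewrite addr_gt0.
have [al [be [q [[al0 be0 albe] [q0 l1al l2be]]]]] := root_pair l1e0_gt0 l2_gt0 l1e0l2.
have ab_gt0 : 0 < al + be by rewrite addr_gt0.
(* [sg] is the midpoint of 1 and 2 / (al + be). *)
exists al, be, ((1 + 2 / (al + be)) / 2), q, e0, (`|c| / 2); split; split => //.
- have : 1 < 2 / (al + be) by rewrite ltr_pdivlMr// mul1r.
  lra.
- rewrite -mulrDr mulrAC mulrDl mul1r divfK ?gt_eqF//; lra.
- split; lra.
- split => //; first by rewrite divr_gt0.
  move=> x xl1.
  have -> : d1 - (1 - x) * p = c + (x - l1) * p by rewrite /c; ring.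
  have : `|(x - l1) * p| <= `|c| / 2.
    rewrite normrM (@le_trans _ _ (e0 * (`|p| + 1)))//.
      by rewrite ler_pM// ?ltW// ltrDl.
    by rewrite -ler_pdivlMr ?ltr_wpDl// -mulrA -invfM.
  have := lerB_dist c (- ((x - l1) * p)); rewrite opprK normrN; lra.
Qed.

Variables (al be sg : R) (q : nat) (e0 c0 : R).
Hypotheses (al_gt0 : 0 < al) (be_gt0 : 0 < be) (sg_gt1 : 1 < sg) (q_gt0 : (0 < q)%N).
Hypothesis albe_lt2 : sg * al + sg * be < 2.
Hypotheses (e0_gt0 : 0 < e0) (e0_lt : e0 < l1) (l1e0_lt1 : l1 + e0 < 1).
Hypothesis l1e0l2 : (l1 + e0) * l2 < 1.
Hypotheses (l1_al : l1 + e0 <= al ^+ q) (l2_be : l2 <= be ^+ q).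
Hypothesis c0_gt0 : 0 < c0.
Hypothesis c0_le : forall x, `|x - l1| < e0 -> c0 <= `|d1 - (1 - x) * (d2 / (1 - l2))|.

Variable phi : R -> R.
Hypothesis phi_test : test_function phi.
Variable nu : probability Sigma R.
Hypothesis nu_half : bernoulli_half nu.

Let l2_gt0 : 0 < l2. Proof. exact: lt_trans l2_gt1. Qed.
Let sgal_gt0 : 0 < sg * al. Proof. by rewrite mulr_gt0// (lt_trans _ sg_gt1). Qed.
Let sgbe_gt0 : 0 < sg * be. Proof. by rewrite mulr_gt0// (lt_trans _ sg_gt1). Qed.

Let G := summable_weights (sg * al) (sg * be).
Let z s := fine (weight_sum (sg * al) (sg * be) s).

Let mG : measurable G. Proof. exact: measurable_summable_weights. Qed.

Let G_full : nu (~` G) = 0%E. Proof. exact: summable_weights_full. Qed.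

Let controlledG s : G s -> controlled al be sg s (z s).
Proof. by move=> Gs m; exact: weight_le_sum. Qed.

Let z_ge0 s : 0 <= z s. Proof. by apply: fine_ge0; exact: weight_sum_ge0. Qed.

Let l1_shift e : `|e| < e0 -> 0 < l1 + e < l1 + e0.
Proof. by rewrite ltr_norml ltrD2l => /andP[ea ->]; rewrite andbT; have := e0_lt; lra. Qed.

Let decayG s e : G s -> `|e| < e0 ->
  forall m, weight (l1 + e) l2 s m <= z s ^+ q * sg^-1 ^+ m.
Proof.
move=> Gs /l1_shift/andP[e1 e2] m.
apply: (controlled_decay l2_gt1 al_gt0 be_gt0 sg_gt1 q_gt0 l1_al l2_be) => //.
  exact: controlledG.
by rewrite e1 ltW.
Qed.

Definition jet (e : R) (j : nat) (s : Sigma) : R := Xjet d1 d2 l2 s j (l1 + e).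

(** For n <= N, the n-th derivative of phi o X(e) along the path, as [derive1n_path] shows on
    [G]. *)
Definition path_derivative N n (e : R) (s : Sigma) : R := faa_trunc phi ((jet e)^~ s) N n.

Lemma is_derive_jet s j (e : R) : G s -> `|e| < e0 ->
  is_derive e 1 (fun e => jet e j s) (jet e j.+1 s).
Proof.
move=> Gs ee0; have /andP[e1 e2] := l1_shift ee0.
have d1' : is_derive (l1 + e) 1 (Xjet d1 d2 l2 s j) (Xjet d1 d2 l2 s j.+1 (l1 + e)).
  apply: (@is_derive_Xjet R d1 d2 (l1 - e0) l2 sg^-1 s l2_gt0 _ (inv_sg01 sg_gt1)
    (l1 + e0) j (z s ^+ q)).
  - by rewrite subr_gt0.
  - by rewrite e2 andbT ltrD2l; move: ee0; rewrite ltr_norml => /andP[].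
  - move=> m; apply: (controlled_decay l2_gt1 al_gt0 be_gt0 sg_gt1 q_gt0 l1_al l2_be).
      exact: controlledG.
    by rewrite lexx andbT addr_gt0.
have d2' : is_derive e 1 (fun e => l1 + e) 1.
  by have := is_deriveD (is_derive_cst l1 e (1 : R)) (is_derive_id e (1 : R)); rewrite add0r.
have := is_derive1_comp d1' d2'.
by rewrite mulr1.
Qed.

Lemma is_derive_path N n s (e : R) : (n < N)%N -> G s -> `|e| < e0 ->
  is_derive e 1 (fun e => path_derivative N n e s) (path_derivative N n.+1 e s).
Proof.
move=> nN Gs ee0.
apply: (@is_derive_faa_trunc R phi (fun j e => jet e j s) N n e nN phi_test.1).
by move=> j; exact: is_derive_jet.
Qed.

Lemma path_derivative0 N s e : `|e| < e0 ->
  path_derivative N 0 e s = phi (Xsum d1 d2 (l1 + e) l2 s).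
Proof.
move=> /l1_shift/andP[e1 _].
by rewrite /path_derivative faa_trunc0 /jet Xjet0// gt_eqF.
Qed.

Lemma derive1n_path N n s e : (n <= N)%N -> G s -> `|e| < e0 ->
  derive1n n (fun e => phi (Xsum d1 d2 (l1 + e) l2 s)) e = path_derivative N n e s.
Proof.
move=> nN Gs ee0.
apply: (@derive1n_chain R _ (fun n e => path_derivative N n e s) e0 N) => //.
  by move=> e' e'e0; rewrite path_derivative0.
by move=> m e' mN e'e0; exact: is_derive_path.
Qed.

Lemma smooth_path s : G s -> smooth_at (fun e => phi (Xsum d1 d2 (l1 + e) l2 s)) 0.
Proof.
move=> Gs; apply: smooth_at_chain => N.
exists (fun n e => path_derivative N n e s), e0; split => //.
  by move=> e' e'e0; rewrite path_derivative0.
by move=> m e' mN e'e0; exact: is_derive_path.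
Qed.

Lemma measurable_path_derivative N n e : `|e| < e0 ->
  measurable_fun setT (path_derivative N n e).
Proof.
move=> /l1_shift/andP[e1 _].
apply: measurable_faa_trunc; first exact: continuous_derive1n.
by move=> j; apply: measurable_Xjet; rewrite gt_eqF.
Qed.

Lemma integrable_z C : nu.-integrable G (EFin \o (fun s => C * z s)).
Proof.
have iz : nu.-integrable G (EFin \o z).
  apply: (eq_integrable mG) (_ : nu.-integrable G (weight_sum (sg * al) (sg * be))).
    by move=> s /set_mem Gs; rewrite /= fineK.
  apply: (integrableS measurableT) => //.
  exact: (integrable_weight_sum nu_half sgal_gt0 sgbe_gt0 albe_lt2).
exact: (integrableZl mG C iz).
Qed.

(** On [G] every path is derivable and a multiple of the integrable z dominates, so differentiation
    under the integral sign applies there; one radius serves all orders up to N. *)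
Lemma is_derive_integral N : (0 < N)%N -> exists dl : R, [/\ 0 < dl, dl < e0,
  (forall n (e : R), (n <= N)%N -> `|e| < dl ->
     nu.-integrable G (EFin \o path_derivative N n e)) &
  (forall n (e : R), (n < N)%N -> `|e| < dl ->
     is_derive e 1 (fun e => \int[nu]_(s in G) path_derivative N n e s)%R
       (\int[nu]_(s in G) path_derivative N n.+1 e s)%R)].
Proof.
move=> N0; have [dl [dl0 dle0 H]] := faa_dominated l1_gt0 l2_gt1 al_gt0 be_gt0 sg_gt1 q_gt0
  e0_gt0 e0_lt l1_al l2_be c0_gt0 c0_le phi_test N0.
have dom n : (n <= N)%N -> exists2 C, 0 <= C & forall s e, G s -> `|e| < dl ->
    `|path_derivative N n e s| <= C * z s.
  move=> nN; have [C C0 CP] := H n nN; exists C => // s e Gs edl.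
  apply: CP; first exact: controlledG.
  by rewrite addrC addKr.
have intD n e : (n <= N)%N -> `|e| < dl ->
    nu.-integrable G (EFin \o path_derivative N n e).
  move=> nN edl; have [C C0 CP] := dom n nN.
  apply: (le_integrable mG _ _ (integrable_z C)).
    apply/measurable_EFinP; apply: measurable_funTS.
    by apply: measurable_path_derivative; exact: lt_trans dle0.
  move=> s Gs; rewrite /= lee_fin [leRHS]ger0_norm ?mulr_ge0//.
  exact: CP.
exists dl; split => // n e nN edl.
have absE (y : R) : `]- dl, dl[%classic y -> `|y| < dl by rewrite /= in_itv/= ltr_norml.
have Ie : `]- dl, dl[%classic e by rewrite /= in_itv/= -ltr_norml.
have lt_e0 (y : R) : `|y| < dl -> `|y| < e0 by move=> /lt_trans; apply.
have [C C0 CP] := dom n.+1 nN.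
have dE y s : `]- dl, dl[%classic y -> G s ->
    partial1of2 (path_derivative N n) y s = path_derivative N n.+1 y s.
  move=> /absE/lt_e0 ye0 Gs; rewrite partial1of2E.
  by have [] := is_derive_path nN Gs ye0.
have intf y : `]- dl, dl[%classic y -> nu.-integrable G (EFin \o path_derivative N n y).
  by move=> /absE ydl; apply: intD => //; exact: ltnW.
have der y s : `]- dl, dl[%classic y -> G s -> derivable ((path_derivative N n)^~ s) y 1.
  by move=> /absE/lt_e0 ye0 Gs; have [] := is_derive_path nN Gs ye0.
have g0 s : 0 <= C * z s by rewrite mulr_ge0.
have gub y s : `]- dl, dl[%classic y -> G s ->
    `|partial1of2 (path_derivative N n) y s| <= C * z s.
  by move=> Iy Gs; rewrite dE//; apply: CP => //; exact: absE.
apply: DeriveDef.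
  exact: (@derivable_under_integral R _ _ nu (path_derivative N n) G mG e (- dl) dl Ie
    intf der (fun s => C * z s) g0 (integrable_z C) gub).
rewrite -derive1E (@differentiation_under_integral R _ _ nu (path_derivative N n) G mG
  e (- dl) dl Ie intf der (fun s => C * z s) g0 (integrable_z C) gub).
by apply: eq_Rintegral => s /set_mem Gs; rewrite dE.
Qed.

Variable mu : R -> R -> probability (measurableTypeR R) R.
Hypothesis mu_stat : forall a b : R, 0 < a -> a < 1 -> 1 < b -> a * b < 1 ->
  stationary d1 d2 a b (mu a b).

Lemma integral_stationary N e : `|e| < e0 ->
  (\int[mu (l1 + e) l2]_x phi x = \int[nu]_(s in G) path_derivative N 0 e s)%R.
Proof.
move=> ee0; have /andP[e1 e2] := l1_shift ee0.
have [B B0 BP] := test_function_bounded phi_test 0.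
have le1 : l1 + e < 1 by exact: lt_trans l1e0_lt1.
have lel2 : (l1 + e) * l2 < 1 by rewrite (lt_trans _ l1e0l2)// ltr_pM2r.
rewrite (@stationary_law R d1 d2 (l1 + e) l2 nu nu_half (mu (l1 + e) l2)
  (mu_stat e1 le1 l2_gt1 lel2) G mG G_full _ _ phi B).
- rewrite /Rintegral (integral_setC_null _ mG)//; congr fine.
  by apply: eq_integral => s _; rewrite path_derivative0.
- by move=> s Gs; exact: (cvg_weight0 l2_gt1 e1 (inv_sg01 sg_gt1) (decayG Gs ee0)).
- by move=> s Gs; exact: (cvg_Xsum l2_gt1 e1 (inv_sg01 sg_gt1) (decayG Gs ee0)).
- by move=> x; exact: (continuous_derive1n phi_test (m := 0)).
- by move=> x; exact: (BP 0%N x).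
Qed.

Let h := fun e : R => (\int[mu (l1 + e) l2]_x phi x)%R.

Lemma smooth_stationary_integral : smooth_at h 0.
Proof.
apply: smooth_at_chain => N.
(* The order N + 1 is taken because [is_derive_integral] asks for a positive one. *)
have [dl [dl0 dle0 _ dP]] := is_derive_integral (ltn0Sn N).
exists (fun n e => \int[nu]_(s in G) path_derivative N.+1 n e s)%R, dl; split => //.
  by move=> e edl; apply: integral_stationary; exact: lt_trans dle0.
by move=> n e nN edl; apply: dP => //; exact: leqW.
Qed.

Let Y s l := faa_sum phi (Xsum d1 d2 l1 l2 s) (fun j => Xder d1 d2 l1 l2 j s) l.

Lemma faa_sum_path s l : G s -> Y s l = path_derivative l l 0 s.
Proof.
move=> Gs; have e00 : `|0 : R| < e0 by rewrite normr0.
have l1_neq0 : l1 != 0 by rewrite gt_eqF.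
rewrite /Y /path_derivative /faa_trunc /faa_sum /jet addr0.
apply: eq_bigr => k _; rewrite Xjet0//; congr (_ * _).
apply: eq_bigr => j _; congr (_ ^+ _); rewrite XjetS//.
apply: (@cvg_Xterm R d1 d2 l1 l2 sg^-1 s l2_gt0 l1_gt0 (inv_sg01 sg_gt1) _ (z s ^+ q)) => //.
by have := decayG Gs e00; rewrite addr0.
Qed.

Lemma measurable_Y l : measurable_fun setT (Y^~ l).
Proof.
(* [faa_trunc] reads the value of X in slot 0 and its derivatives in the later slots. *)
pose y j s := if j is j'.+1 then Xder d1 d2 l1 l2 j s else Xsum d1 d2 l1 l2 s.
apply: (@measurable_faa_trunc R _ Sigma phi y l l).
  exact: continuous_derive1n.
by case=> [|j]; [exact: measurable_Xsum|exact: measurable_Xder].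
Qed.

Lemma integrable_Y l : (0 < l)%N -> nu.-integrable setT (fun s => (Y s l)%:E).
Proof.
move=> l0; have [dl [dl0 dle0 intD _]] := is_derive_integral l0.
have d00 : `|0 : R| < dl by rewrite normr0.
have /integrableP[_ int0] := intD l 0 (leqnn l) d00.
apply/integrableP; split; first by apply/measurable_EFinP; exact: measurable_Y.
rewrite (integral_setC_null _ mG)//; apply: le_lt_trans int0.
by under eq_integral => s /set_mem Gs do rewrite faa_sum_path//.
Qed.

(** On [G] both integrands equal [path_derivative l l 0]. Off this set X may be a default value of
    [limn], but the set is null and [integral_setC_null] discards it. *)
Lemma derive1n_stationary_integral l : (0 < l)%N ->
  [/\ (derive1n l h 0)%:E = (\int[nu]_s (derive1n l
          (fun e => phi (Xsum d1 d2 (l1 + e) l2 s)) 0)%:E)%E &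
      (\int[nu]_s (derive1n l (fun e => phi (Xsum d1 d2 (l1 + e) l2 s)) 0)%:E =
       \int[nu]_s (Y s l)%:E)%E].
Proof.
move=> l0; have [dl [dl0 dle0 intD dP]] := is_derive_integral l0.
have d00 : `|0 : R| < dl by rewrite normr0.
have e00 : `|0 : R| < e0 by rewrite normr0.
have E1 : (\int[nu]_s (derive1n l (fun e => phi (Xsum d1 d2 (l1 + e) l2 s)) 0)%:E =
    \int[nu]_(s in G) (path_derivative l l 0 s)%:E)%E.
  rewrite (integral_setC_null _ mG)//; apply: eq_integral => s /set_mem Gs.
  by rewrite (derive1n_path (leqnn l)).
have E2 : (\int[nu]_s (Y s l)%:E = \int[nu]_(s in G) (path_derivative l l 0 s)%:E)%E.
  rewrite (integral_setC_null _ mG)//; apply: eq_integral => s /set_mem Gs.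
  by rewrite faa_sum_path.
split; last by rewrite E1 E2.
rewrite E1.
rewrite (@derive1n_chain R h (fun n e => \int[nu]_(s in G) path_derivative l n e s)%R dl l)//.
  by rewrite /Rintegral fineK//; apply: integrable_fin_num => //; exact: intD.
by move=> e edl; apply: integral_stationary; exact: lt_trans dle0.
Qed.

Lemma ae_smooth_path :
  \forall s \ae nu, smooth_at (fun e => phi (Xsum d1 d2 (l1 + e) l2 s)) 0.
Proof.
exists (~` G); split => //; first exact: measurableC.
by move=> s ns Gs; apply: ns; exact: smooth_path.
Qed.

End Main.

Theorem theorem1p3 (R : realType) (l1 l2 d1 d2 : R)
    (nu : probability Sigma R)
    (mu : R -> R -> probability (measurableTypeR R) R)
    (phi : R -> R) :
  0 < l1 -> l1 < 1 -> 1 < l2 -> l1 * l2 < 1 ->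
  d1 / (1 - l1) != d2 / (1 - l2) ->
  bernoulli_half nu ->
  (forall a b : R, 0 < a -> a < 1 -> 1 < b -> a * b < 1 ->
    stationary d1 d2 a b (mu a b)) ->
  test_function phi ->
  let h := fun e : R => \int[mu (l1 + e) l2]_x phi x in
  let phiX := fun (s : Sigma) (e : R) => phi (Xsum d1 d2 (l1 + e) l2 s) in
  let Y := fun (s : Sigma) (l : nat) =>
    faa_sum phi (Xsum d1 d2 l1 l2 s) (fun j => Xder d1 d2 l1 l2 j s) l in
  smooth_at h 0 /\
  (\forall s \ae nu, smooth_at (phiX s) 0) /\
  forall l : nat, (1 <= l)%N ->
    [/\ ((derive1n l h 0)%:E = \int[nu]_s (derive1n l (phiX s) 0)%:E)%E,
        (\int[nu]_s (derive1n l (phiX s) 0)%:E = \int[nu]_s (Y s l)%:E)%E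
      & nu.-integrable setT (fun s => (Y s l)%:E) ].
Proof.
move=> l1_gt0 l1_lt1 l2_gt1 l12 neq_fix nu_half mu_stat phi_test h phiX Y.
have [al [be [sg [q [e0 [c0 [[al0 be0 sg1 q0 ab2] [[e00 e0l1 l1e0 l1e0l2]
  [l1al l2be c00 c0P]]]]]]]]] := parameters_exist l1_gt0 l2_gt1 l1_lt1 l12 neq_fix.
split; [|split].
- by apply: (@smooth_stationary_integral R l1 l2 d1 d2 l1_gt0 l2_gt1 al be sg q e0 c0).
- by apply: (@ae_smooth_path R l1 l2 d1 d2 l1_gt0 l2_gt1 al be sg q e0).
- move=> l l0.
  have [E1 E2] := @derive1n_stationary_integral R l1 l2 d1 d2 l1_gt0 l2_gt1 al be sg q e0 c0
    al0 be0 sg1 q0 ab2 e00 e0l1 l1e0 l1e0l2 l1al l2be c00 c0P phi phi_test nu nu_half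
    mu mu_stat l l0.
  split => //.
  by apply: (@integrable_Y R l1 l2 d1 d2 l1_gt0 l2_gt1 al be sg q e0 c0).
Qed.
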